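(* Let $j,k\ge 1$ be integers. Then \[ \Delta(j,k)\le \Big\lceil j+(2^{k-1}-1)\,2^{\lfloor \log_2(j-\frac12)\rfloor}\Big\rceil . \] Equivalently, for integers $j=2^n+r$ with $n\ge 0$ and $1\le r\le 2^n$ one has \[ \Delta(2^n+r,k)\le 2^{n+k-1}+r, \] and \[ \Delta(1,k)\le \begin{cases} 2^{k-2}+1, & \text{if } k\ge 2,\\ 1, & \text{if } k=1.\end{cases} \]
   Context: A mass on $\mathbb{R}^d$ is a finite Borel measure on $\mathbb{R}^d$ that vanishes on every affine hyperplane. An arrangement of $k$ affine hyperplanes in $\mathbb{R}^d$ partitions its complement into $2^k$ (possibly empty) orthants: choosing an orientation of each hyperplane, the orthants are the intersections obtained by choosing one of the two open sides of each of the $k$ hyperplanes. A mass $\mu$ is equiparted by the arrangement if each of the $2^k$ orthants has measure $\frac{1}{2^k}\mu(\mathbb{R}^d)$. For integers $j,k\ge1$, $\Delta(j,k)$ denotes the minimal dimension $d\ge 1$ such that for any $j$ masses on $\mathbb{R}^d$ there exists an arrangement of $k$ affine hyperplanes in $\mathbb{R}^d$ that simultaneously equiparts all $j$ masses. *)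

(* Defs.v *)
From HB Require Import structures.
From mathcomp Require Import all_boot all_order all_algebra.
From mathcomp Require Import all_classical all_reals all_analysis.
Set Implicit Arguments.
Unset Strict Implicit.
Unset Printing Implicit Defensive.
Import Order.TTheory GRing.Theory Num.Theory.
Import numFieldNormedType.Exports.
Local Open Scope classical_set_scope.
Local Open Scope ring_scope.

Notation borel_rV R d := (g_sigma_algebraType (@open 'rV[R]_d)).

Definition dotv (R : realType) (d : nat) (u v : 'rV[R]_d) : R :=
  \sum_(i < d) u ord0 i * v ord0 i.

(* The hyperplane {x | <normal, x> = offset}, oriented by its normal vector. *)
Record hyperplane (R : realType) (d : nat) := Hyperplane {
  normal : 'rV[R]_d;
  offset : R;
  normal_neq0 : normal != 0 }.

Definition hyperplane_set (R : realType) (d : nat) (H : hyperplane R d)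
  : set 'rV[R]_d := [set x | dotv (normal H) x = offset H].

Definition open_side (R : realType) (d : nat) (H : hyperplane R d) (s : bool)
  : set 'rV[R]_d :=
  if s then [set x | offset H < dotv (normal H) x]
  else [set x | dotv (normal H) x < offset H].

Record mass (R : realType) (d : nat) := Mass {
  mass_measure :> {finite_measure set (borel_rV R d) -> \bar R};
  mass_hyperplane : forall H : hyperplane R d,
    mass_measure (hyperplane_set H) = 0%E }.

(* An arrangement of k hyperplanes is a family indexed by 'I_k, and its
   orthants are indexed by the sign vectors s : 'I_k -> bool. *)
Definition orthant (R : realType) (d k : nat) (H : 'I_k -> hyperplane R d)
    (s : 'I_k -> bool) : set 'rV[R]_d :=
  [set x | forall i, open_side (H i) (s i) x].

Definition equiparts (R : realType) (d k : nat) (H : 'I_k -> hyperplane R d)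
    (mu : mass R d) : Prop :=
  forall s : 'I_k -> bool,
    mu (orthant H s) = ((2 ^+ k)^-1%:E * mu [set: 'rV[R]_d])%E.

Definition equipartable (R : realType) (j k d : nat) : Prop :=
  forall mu : 'I_j -> mass R d,
    exists H : 'I_k -> hyperplane R d, forall i, equiparts H (mu i).

(* The minimum is a relation because its existence is not known a priori. *)
Definition is_Delta (R : realType) (j k D : nat) : Prop :=
  [/\ (1 <= D)%N, equipartable R j k D &
      forall d, (1 <= d)%N -> equipartable R j k d -> (D <= d)%N].

Definition log2 (R : realType) (x : R) : R := ln x / ln 2.

(* Main.v *)
(* A family of k affine hyperplanes of R^d is a point of (S^d)^k, a row of
   d + 1 coefficients per hyperplane.  The orthant measures of a mass have
   Fourier coefficients f_A, A a subset of the rows, with f_A odd in the rows of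
   A and even in the others, and the mass is equiparted iff f_A = 0 for A
   nonempty.  Bounding the rows by a subdivided cube reduces a common zero to
   a parity argument on F_2-valued cellular cochains.  Each f_A gives a sign
   label lam_A, and R |-> d(lam_A R) multiplies by the linear form
   t_A = sum of t_l over l in A; if on every cell some f_A has constant sign, the
   coefficient of (t_1 ... t_k)^d in the product of the t_A is 0.

   For at least two masses the symmetry exchanging two rows a, b lowers the
   dimension further.  On the fixed locus of rows equal up to sign
   f_ab is plus or minus the total mass, so all cochains involved vanish near
   it, and away from it the last class t_ab can be replaced by t_a at the cost
   of keeping all cochains symmetric; non-symmetric labels are treated in pairs
   exchanged by the swap.  The coefficient so obtained is 1: with q = 2^(n+1)
   masses it is that of the q-th power of the Dickson product of all nonzero
   linear forms, divided by t_ab and multiplied by t_a.  For j = 2^n + r masses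
   the forms t_l are dropped, and the others kept, for the missing q - j ones.

   One mass reduces to two masses and one hyperplane less by bisecting it. *)

Require Import Defs.
From HB Require Import structures.
From mathcomp Require Import all_boot all_order all_algebra.
From mathcomp Require Import perm zify lra ring boolp.
From mathcomp Require Import -(notations) mpoly.
Set Implicit Arguments.
Unset Strict Implicit.
Unset Printing Implicit Defensive.
Import Order.TTheory GRing.Theory Num.Theory.
Local Open Scope ring_scope.

(** * Cochains modulo 2 on a subdivided cube *)

(** The swap pays off because of a division. In the q-th power of the Dickson product, with q =
    2^(n+1), the leading monomial has exponents A = q 2^(k-1) and B = q at the extreme rows a and b,
    so a direct argument needs dimension A. But (t_a^A t_b^B + t_a^B t_b^A) / (t_a + t_b) is the sum
    of all monomials in between, including the one with exponents (A + B)/2 - 1 and (A + B)/2;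
    multiplied by t_a it becomes balanced, in dimension (A + B)/2. The obstacle is that the swap has
    fixed points, where a parity count fails, and that products of cochains commute only up to
    coboundaries, so the product of two exchanged labels is not symmetric. Both are cured by
    vanishing near the diagonal, which costs one class t_ab; the other one is the divisor. Hence two
    masses are required. Dropping t_l for every row l lowers all exponents by the same amount, so
    other numbers of masses need no new coefficient. A row with zero normal is a hyperplane at
    infinity. It is excluded only at the end, because it leaves an orthant empty. *)

Section Char2.
Variables (F : comNzRingType) (pcharF : 2 \in [pchar F]).

(** The points that [h] moves come in pairs with equal terms, which cancel in characteristic two;
    [enum_rank] singles out one point of each pair. *)
Lemma sum_involution (T : finType) (f : T -> F) (h : T -> T) :
  involutive h -> (forall x, f (h x) = f x) ->
  (forall x, h x = x -> f x = 0) -> \sum_x f x = 0.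
Proof.
move=> hK fh f0; pose r := @enum_rank T.
rewrite (bigID (fun x => r x < r (h x))%N) /=.
rewrite [X in _ + X](bigID (fun x => r (h x) < r x)%N) /=.
rewrite [X in _ + (_ + X)]big1 ?addr0; last first.
  move=> x; rewrite -!leqNgt => le_r; apply: f0; apply: enum_rank_inj.
  exact/val_inj/anti_leq.
rewrite [X in _ + X](reindex_inj (inv_inj hK)) /=.
rewrite [X in _ + X](eq_big (fun x => r x < r (h x))%N f) ?(addrr_pchar2 pcharF) // => x.
by rewrite hK; case: ltngtP.
Qed.

End Char2.

Section Cube.
Variables (c : nat) (C : finType).

(* Grid cells of the cube, one coordinate in 0 .. 2c per direction: even
   coordinates are vertices, odd ones are edges.  For c odd the centre c is
   an edge. *)
Definition coord := 'I_(c.*2.+1).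
Definition cell := {ffun C -> coord}.

Definition shift (b : bool) (a : coord) : coord :=
  inord (if b then a.+1 else a.-1).
Definition put (v : cell) (x : C) (a : coord) : cell :=
  [ffun y => if y == x then a else v y].
Definition face (v : cell) (x : C) (b : bool) : cell :=
  put v x (shift b (v x)).

Lemma shiftE b (a : coord) :
  odd a -> shift b a = (if b then a.+1 else a.-1) :> nat.
Proof. by move=> oa; rewrite /shift inordK //; case: a oa; case: b => /=; lia. Qed.

Lemma odd_shift b (a : coord) : odd a -> odd (shift b a) = false.
Proof. by move=> oa; rewrite shiftE //; case: a oa; case: b => /=; lia. Qed.

Implicit Types (v u w : cell).

Lemma put_same v x a : put v x a x = a.
Proof. by rewrite ffunE eqxx. Qed.

Lemma put_diff v x y a : y != x -> put v x a y = v y.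
Proof. by rewrite ffunE => /negPf->. Qed.

Lemma putC v x y a b : x != y -> put (put v x a) y b = put (put v y b) x a.
Proof.
move=> xy; apply/ffunP=> z; rewrite !ffunE; case: (eqVneq z y) => // ->.
by rewrite eq_sym (negPf xy).
Qed.

Lemma put_put v x a b : put (put v x a) x b = put v x b.
Proof. by apply/ffunP=> z; rewrite !ffunE; case: eqP. Qed.

Lemma put_id v x : put v x (v x) = v.
Proof. by apply/ffunP=> z; rewrite !ffunE; case: eqP => [->|]. Qed.

Lemma odd_face v x b y : odd (v x) ->
  odd (face v x b y) = (y != x) && odd (v y).
Proof.
move=> ox; rewrite /face ffunE; case: eqVneq => //= _; exact: odd_shift.
Qed.

Lemma faceC v x y b b' : x != y ->
  face (face v x b) y b' = face (face v y b') x b.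
Proof.
move=> xy; have yx : y != x by rewrite eq_sym.
by rewrite /face (put_diff v _ yx) (put_diff v _ xy) putC.
Qed.

(** The coface lies opposite to [b], so the bound is at the other end of the grid. Without it
    [shift] would leave the vertex in place or fall back to 0. *)
Definition in_range (b : bool) (a : coord) :=
  if b then (0 < a)%N else (a < c.*2)%N.
(* [coface v x b] is the cell having [v] as its [b]-face in direction [x]. *)
Definition coface v x b : cell := put v x (shift (~~ b) (v x)).

Lemma face_coface u x b : ~~ odd (u x) -> in_range b (u x) ->
  odd (coface u x b x) /\ face (coface u x b) x b = u.
Proof.
move=> ev inr; have sE : shift (~~ b) (u x) = (if b then (u x).-1 else (u x).+1) :> nat.
  by rewrite inordK; case: b inr => /=; case: (u x) => a /=; lia.
have od : odd (coface u x b x).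
  by rewrite /coface put_same sE; case: b inr {sE} => /=; case: (u x) ev => a /=; lia.
split=> //; rewrite /face /coface put_put -[RHS](put_id u x); congr put.
apply: ord_inj; rewrite shiftE //; rewrite put_same sE.
by case: b inr {sE od} => /=; case: (u x) ev => a /=; lia.
Qed.

Lemma coface_face v x b : odd (v x) ->
  [/\ ~~ odd (face v x b x), in_range b (face v x b x) &
      coface (face v x b) x b = v].
Proof.
move=> ox; have sE := shiftE b ox.
rewrite /face put_same odd_shift // /in_range sE.
split=> //; first by case: b {sE}; move: ox; case: (v x) => a /=; lia.
rewrite /coface put_put put_same -[RHS](put_id v x); congr put.
apply: ord_inj; rewrite inordK sE.
  by case: b {sE}; move: ox; case: (v x) => a /=; lia.
by case: b {sE}; move: ox; case: (v x) => a /=; lia.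
Qed.

Variables (F : comNzRingType) (pcharF : 2 \in [pchar F]).
Implicit Types R : cell -> F.

Definition cobd R v : F :=
  \sum_(x | odd (v x)) \sum_(b : bool) R (face v x b).

Lemma cobdD R R' v : cobd (fun u => R u + R' u) v = cobd R v + cobd R' v.
Proof.
rewrite /cobd -big_split; apply: eq_bigr => x _; rewrite -big_split.
by apply: eq_bigr.
Qed.

Lemma eq_cobd R R' v :
  (forall x b, odd (v x) -> R (face v x b) = R' (face v x b)) ->
  cobd R v = cobd R' v.
Proof.
by move=> eqR; apply: eq_bigr => x ox; apply: eq_bigr => b _; apply: eqR.
Qed.

Lemma cobd0 v : cobd (fun=> 0) v = 0.
Proof. by rewrite /cobd big1 // => x _; rewrite big1. Qed.

Lemma cobdZ a R v : cobd (fun u => a * R u) v = a * cobd R v.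
Proof.
rewrite /cobd mulr_sumr; apply: eq_bigr => x _; rewrite mulr_sumr.
by apply: eq_bigr.
Qed.

Lemma cobd_sum (I : Type) (s : seq I) (R : I -> cell -> F) v :
  cobd (fun u => \sum_(i <- s) R i u) v = \sum_(i <- s) cobd (R i) v.
Proof.
elim: s => [|i s IHs].
  by rewrite [RHS]big_nil -[RHS](cobd0 v); apply: eq_cobd => x b _; rewrite big_nil.
rewrite [RHS]big_cons -IHs -cobdD; apply: eq_cobd => x b _.
by rewrite big_cons.
Qed.

(** A face of codimension two is reached by leaving its two directions in either order; the
    involution exchanges the orders. *)
Lemma cobd_cobd R v : cobd (cobd R) v = 0.
Proof.
pose G x y := \sum_b \sum_b' R (face (face v x b) y b').
have -> : cobd (cobd R) v =
    \sum_(p : C * C) if odd (v p.1) && ((p.2 != p.1) && odd (v p.2))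
                     then G p.1 p.2 else 0.
  rewrite -big_mkcond /= -(pair_big_dep (fun x => odd (v x))
     (fun x y => (y != x) && odd (v y)) G) /=.
  apply: eq_bigr => x ox; rewrite /G exchange_big /=.
  apply: eq_bigr => b _; rewrite /cobd; apply: eq_bigl => y.
  exact: odd_face.
apply: (sum_involution pcharF (h := fun p => (p.2, p.1))) => [[]//|[x y]|[x y]] /=.
  rewrite eq_sym; case: (odd (v x)); case: (odd (v y)); rewrite ?andbF //=.
  rewrite andbT; case: eqVneq => //= yx.
  rewrite /G exchange_big; apply: eq_bigr => b _.
  by apply: eq_bigr => b' _; rewrite faceC // eq_sym.
by case=> -> _; rewrite eqxx andbF.
Qed.

(** The cellular boundary of [R] read as a chain. *)
Definition bound R u : F :=
  \sum_x \sum_(b | ~~ odd (u x) && in_range b (u x)) R (coface u x b).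

Lemma eq_bound R R' u :
  (forall x b, ~~ odd (u x) -> in_range b (u x) ->
     R (coface u x b) = R' (coface u x b)) -> bound R u = bound R' u.
Proof.
by move=> eqR; apply: eq_bigr => x _; apply: eq_bigr => b /andP[]; apply: eqR.
Qed.

Lemma boundD R R' u : bound (fun v => R v + R' v) u = bound R u + bound R' u.
Proof.
rewrite /bound -big_split; apply: eq_bigr => x _; rewrite -big_split.
by apply: eq_bigr.
Qed.

(** Stokes formula: both sides sum over the incident pairs of a cell and a face. *)
Lemma sum_cobd R R' :
  \sum_v R v * cobd R' v = \sum_u bound R u * R' u.
Proof.
rewrite /cobd /bound.
under eq_bigr do rewrite mulr_sumr big_mkcond.
under [RHS]eq_bigr do rewrite mulr_suml.
rewrite exchange_big [RHS]exchange_big; apply: eq_bigr => x _ /=.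
rewrite -big_mkcond /=.
under eq_bigr do rewrite mulr_sumr.
under [RHS]eq_bigr do rewrite mulr_suml big_mkcond.
rewrite exchange_big [RHS]exchange_big; apply: eq_bigr => b _ /=.
rewrite -[RHS]big_mkcond /=.
rewrite (reindex_onto (fun u => coface u x b) (fun v => face v x b)) /=; last first.
  by move=> v /(coface_face b)[].
apply: eq_big => [u|u /andP[_ /eqP->] //].
apply/andP/andP => [[ox /eqP fu]|[ev inr]].
  by have [] := coface_face b ox; rewrite fu.
by have [-> ->] := face_coface ev inr.
Qed.

End Cube.

(** * The antipodal sphere as the boundary of the cube *)

Section Sphere.
Variables (c d : nat).
Hypothesis odd_c : odd c.
Let c_gt0 : (0 < c)%N := odd_gt0 odd_c.
Local Notation coord := (coord c).
Local Notation sphere := (cell c 'I_d.+1).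
Implicit Types (x y : sphere) (i : 'I_d.+1) (b : bool) (a : coord).

Definition extreme a := (a == ord0) || (a == ord_max).
Definition antipode x : sphere := [ffun i => rev_ord (x i)].
(** Cells of the boundary of the cube. The antipode moves all of them, whereas it fixes the central
    cell of the cube. *)
Definition valid_row x := [exists i, extreme (x i)].
Definition rank x := #|[set i | odd (x i)]|.
(* One cell of each dimension r, up to signs of the other coordinates: the edges
   are directions 1 .. r, all at the centre. *)
Definition standard x :=
  [forall i : 'I_d.+1, if (0 < i <= rank x)%N then x i == c :> nat else ~~ odd (x i)].

Lemma rev_coordE a : rev_ord a = (c.*2 - a)%N :> nat.
Proof. by rewrite /= subSS. Qed.

Lemma odd_rev_coord a : odd (rev_ord a) = odd a.
Proof. by rewrite rev_coordE; case: a => a /=; lia. Qed.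

Lemma extremeE a : extreme a = ((a == 0%N :> nat) || (a == c.*2 :> nat)).
Proof. by []. Qed.

Lemma extreme_rev a : extreme (rev_ord a) = extreme a.
Proof. by rewrite !extremeE rev_coordE; case: a => a /=; lia. Qed.

Lemma extreme_even a : extreme a -> ~~ odd a.
Proof. by rewrite extremeE; case: a => a /=; lia. Qed.

Lemma antipodeK : involutive antipode.
Proof. by move=> x; apply/ffunP=> i; rewrite !ffunE rev_ordK. Qed.

Lemma rank_antipode x : rank (antipode x) = rank x.
Proof. by apply: eq_card => i; rewrite !inE ffunE odd_rev_coord. Qed.

Lemma valid_antipode x : valid_row (antipode x) = valid_row x.
Proof. by apply: eq_existsb => i; rewrite ffunE extreme_rev. Qed.

Lemma antipode_neq x : valid_row x -> antipode x != x.
Proof.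
case/existsP=> i ext; apply/eqP=> /ffunP/(_ i); rewrite ffunE => eqx.
by move: ext (congr1 val eqx); rewrite extremeE; case: (x i) => a /=; lia.
Qed.

Lemma standard_antipode x : standard (antipode x) = standard x.
Proof.
apply: eq_forallb => i; rewrite rank_antipode ffunE odd_rev_coord rev_coordE.
by case: ifP => // _; case: (x i) => a /=; lia.
Qed.

Lemma face_antipode x i b : odd (x i) ->
  face (antipode x) i b = antipode (face x i (~~ b)).
Proof.
move=> ox; apply/ffunP=> j; rewrite !ffunE; case: eqVneq => // _.
apply: ord_inj; rewrite rev_coordE !shiftE ?odd_rev_coord // rev_coordE.
by case: b; case: (x i) ox => a /=; lia.
Qed.

Lemma rank_face x i b : odd (x i) -> rank x = (rank (face x i b)).+1.
Proof.
move=> ox; rewrite /rank (cardsD1 i) inE ox add1n; congr _.+1.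
by apply: eq_card => j; rewrite !inE odd_face.
Qed.

Lemma valid_face_row x i b : odd (x i) -> valid_row x -> valid_row (face x i b).
Proof.
move=> ox /existsP[j ext]; apply/existsP; exists j; rewrite put_diff //.
by apply: contraTneq ox => <-; apply: extreme_even.
Qed.

Lemma rank_valid x : valid_row x -> (rank x <= d)%N.
Proof.
case/existsP=> j /extreme_even ev; rewrite -ltnS -[d.+1]card_ord -cardsT.
apply: proper_card; apply/properP; split; first exact: subsetT.
by exists j; rewrite ?inE.
Qed.

(** At [i] both faces are even, hence different from the odd [c]; only the parity of this coordinate
    matters, and it is the same for both. *)
Lemma standard_face x i b b' : odd (x i) ->
  standard (face x i b) = standard (face x i b').
Proof.
move=> ox; apply: eq_forallb => j.
have -> : rank (face x i b) = rank (face x i b').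
  by apply: succn_inj; rewrite -!rank_face.
case: (eqVneq j i) => [->|ji]; last by rewrite /face !(put_diff x _ ji).
rewrite !odd_face // eqxx /=.
by case: ifP => // _; rewrite /face !put_same !shiftE //; case: b b' => -[];
   case: (x i) ox => a /=; lia.
Qed.

Lemma coface_antipode x i b : ~~ odd (x i) -> in_range b (x i) ->
  coface (antipode x) i (~~ b) = antipode (coface x i b).
Proof.
move=> ev inr; have [oy fy] := face_coface ev inr.
set y := coface x i b in oy fy *.
have oy' : odd (antipode y i) by rewrite ffunE odd_rev_coord.
have [_ _] := coface_face (~~ b) oy'.
by rewrite face_antipode // negbK fy.
Qed.

Lemma in_range_rev b a : in_range b (rev_ord a) = in_range (~~ b) a.
Proof. by rewrite /in_range rev_coordE; case: b; case: a => a /=; lia. Qed.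

Lemma valid_coface_row x i b : ~~ odd (x i) -> in_range b (x i) ->
  valid_row (coface x i b) -> valid_row x.
Proof.
move=> ev inr; have [oy {2}<-] := face_coface ev inr.
exact: valid_face_row.
Qed.

Definition top_row x := valid_row x && (rank x == d).

Variables (F : comNzRingType) (pcharF : 2 \in [pchar F]).
Let F2D := addrr_pchar2 pcharF.

(* The sign of the first coordinate after the edges of a standard cell; the
   choice on cells centred in that direction is arbitrary but odd. *)
Definition sgn x : F :=
  let i := inord (if (rank x < d)%N then (rank x).+1 else 0) in
  if x i == c :> nat then (enum_rank x < enum_rank (antipode x))%N%:R
  else (x i < c)%N%:R.

Lemma sgn_antipode x : valid_row x -> sgn (antipode x) = sgn x + 1.
Proof.
move=> vx; rewrite /sgn rank_antipode antipodeK ffunE rev_coordE.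
set i := inord _; set a := x i; clearbody a.
have ->: ((c.*2 - a)%N == c) = (a == c :> nat) by case: a => a /=; lia.
case: eqP => [_|nac].
  have : enum_rank x != enum_rank (antipode x).
    by rewrite (inj_eq enum_rank_inj) eq_sym antipode_neq.
  rewrite -val_eqE /=; set p := nat_of_ord _; set q := nat_of_ord _ => /eqP npq.
  by case: (ltngtP p q) => //= _; rewrite ?F2D ?add0r.
have -> : (c.*2 - a < c)%N = ~~ (a < c)%N by case: a nac => a /=; lia.
by case: (_ < _)%N => /=; rewrite ?F2D ?add0r.
Qed.

Lemma cobd_standard x : cobd (fun u => (standard u)%:R : F) x = 0.
Proof.
by rewrite /cobd big1 // => i ox; rewrite big_bool (standard_face true false) //= F2D.
Qed.

(** This is t * t^(r-1) = t^r with explicit representatives. Opposite faces are standard together,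
    so a direction contributes the difference of their signs; it is nonzero only across the centre
    of direction [r], the coordinate that [sgn] reads on cells of rank r - 1. *)
Lemma cobd_sgn_standard x : valid_row x ->
  cobd (fun u => sgn u * (standard u)%:R) x = (0 < rank x)%N%:R * (standard x)%:R.
Proof.
move=> vx; case: (posnP (rank x)) => [r0|r_gt0].
  rewrite mul0r /cobd big_pred0 // => i; move/eqP: r0; rewrite cards_eq0.
  by move/eqP/setP/(_ i); rewrite !inE.
rewrite mul1r.
have rd := rank_valid vx.
move r_def: (rank x) r_gt0 rd => r r_gt0 rd.
have rf i b : odd (x i) -> rank (face x i b) = r.-1.
  by move=> ox; rewrite -r_def (rank_face b ox).
have [j jE] : exists j : 'I_d.+1, j = r :> nat by exists (inord r); rewrite inordK.
have sgn_face i b : odd (x i) -> standard (face x i b) ->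
    sgn (face x i b) = (face x i b j < c)%N%:R.
  move=> ox st; rewrite /sgn rf // prednK // rd -jE inord_val.
  have := forallP st j; rewrite rf // jE.
  have -> : (0 < r <= r.-1)%N = false by lia.
  by case: eqP => // ->; rewrite odd_c.
have term i : odd (x i) ->
    \sum_b sgn (face x i b) * (standard (face x i b))%:R =
    ((i == j) && standard x)%:R :> F.
  have aux (a a' : F) (p : bool) : a * p%:R + a' * p%:R = if p then a + a' else 0.
    by case: p; rewrite ?mulr1 // !mulr0 addr0.
  move=> ox; rewrite big_bool (standard_face true false) //= aux.
  case: (boolP (standard (face x i false))) => [st|nst]; last first.
    case: eqP => [ij|_]; last by rewrite andFb.
    rewrite andTb; suff /negPf-> : ~~ standard x by [].
    apply: contraNN nst => /forallP st; apply/forallP=> i'.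
    rewrite rf //; move: (st i'); rewrite r_def.
    case: (eqVneq i' i) => [->|ni].
      have -> : (0 < i <= r.-1)%N = false by rewrite ij jE; lia.
      by rewrite odd_face // eqxx.
    rewrite {1 2}/face !(put_diff x _ ni).
    have nr : i' != r :> nat by rewrite -jE -ij.
    suff -> : (0 < i' <= r.-1)%N = (0 < i' <= r)%N by [].
    lia.
  have st' : standard (face x i true) by rewrite (standard_face true false).
  rewrite (sgn_face _ _ ox st') (sgn_face _ _ ox st).
  case: (eqVneq i j) => [ij|ij]; last first.
    have ji : j != i by rewrite eq_sym.
    by rewrite /face !(put_diff x _ ji) F2D.
  rewrite -ij /face !put_same !shiftE //=.
  have -> : standard x = (x i == c :> nat).
    apply/forallP/idP => [/(_ i)|xic i'].
      by rewrite r_def ij jE r_gt0 leqnn.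
    move/forallP/(_ i'): st; rewrite rf // r_def.
    case: (eqVneq i' i) => [->|ni].
      by rewrite ij jE r_gt0 leqnn -ij xic.
    rewrite {1 2}/face !(put_diff x _ ni).
    have nr : i' != r :> nat by rewrite -jE -ij.
    suff -> : (0 < i' <= r.-1)%N = (0 < i' <= r)%N by [].
    lia.
  case: (ltngtP (x i) c) => xic.
  - have -> : ((x i).+1 < c)%N by lia.
    have -> : ((x i).-1 < c)%N by lia.
    exact: F2D.
  - have -> : ((x i).+1 < c)%N = false by lia.
    have -> : ((x i).-1 < c)%N = false by lia.
    exact: F2D.
  - have -> : ((x i).+1 < c)%N = false by lia.
    have -> : ((x i).-1 < c)%N by lia.
    exact: add0r.
rewrite /cobd (eq_bigr _ term).
case: (boolP (standard x)) => st; last by rewrite big1 // => i _; rewrite andbF.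
have xj : x j = c :> nat.
  by move/forallP/(_ j): st; rewrite jE r_def r_gt0 leqnn => /eqP.
rewrite (bigD1 j) ?xj //= eqxx big1 ?addr0 // => i /andP[_ /negPf->].
by rewrite mulr0n.
Qed.

(* Summing over [top_weight] keeps one top cell of each antipodal pair. *)
Definition top_weight x : F := (top_row x)%:R * sgn x.

Lemma bound_antipode (W : sphere -> F) x :
  bound W (antipode x) = bound (fun y => W (antipode y)) x.
Proof.
apply: eq_bigr => i _; rewrite ffunE odd_rev_coord.
rewrite (reindex_inj negb_inj) /=; apply: eq_big => [b|b].
  by rewrite in_range_rev negbK.
by rewrite in_range_rev negbK => /andP[ev inr]; rewrite coface_antipode.
Qed.

(** All top cells together form a cycle. A cell with exactly two even coordinates [p], [q] has valid
    cofaces in direction [p] only if [q] is extreme, and their number is odd exactly if [p] is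
    extreme too; this count is symmetric in [p] and [q]. *)
Lemma bound_top_row x : (0 < d)%N ->
  bound (fun y => (top_row y)%:R : F) x = 0.
Proof.
move=> d_gt0.
have rank_coface i b : ~~ odd (x i) -> in_range b (x i) ->
    rank (coface x i b) = (rank x).+1.
  by move=> ev inr; have [oy fy] := face_coface ev inr; rewrite (rank_face b oy) fy.
case: (eqVneq (rank x).+1 d) => [rx|nrx]; last first.
  apply: big1 => i _; apply: big1 => b /andP[ev inr].
  by rewrite /top_row rank_coface // (negPf nrx) andbF.
have : #|~: [set i | odd (x i)]| == 2.
  rewrite cardsCs setCK card_ord -/(rank x); apply/eqP; lia.
case/cards2P=> p [q [pq /setP evE]].
have ev i : ~~ odd (x i) = (i == p) || (i == q) by have := evE i; rewrite !inE.
have term i j : i != j -> (forall l, ~~ odd (x l) = (l == i) || (l == j)) ->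
    \sum_(b | ~~ odd (x i) && in_range b (x i)) (top_row (coface x i b))%:R
    = (extreme (x j) && extreme (x i))%:R :> F.
  move=> ij evij; have evi : ~~ odd (x i) by rewrite evij eqxx.
  have -> : \sum_(b | ~~ odd (x i) && in_range b (x i)) (top_row (coface x i b))%:R
      = \sum_(b | in_range b (x i)) (extreme (x j))%:R :> F.
    rewrite evi; apply: eq_bigr => b inr; congr (_%:R); congr nat_of_bool.
    rewrite /top_row rank_coface // rx eqxx andbT.
    have [oy fy] := face_coface evi inr.
    apply/existsP/idP => [[l ext]|extj]; last first.
      by exists j; rewrite /coface put_diff // eq_sym.
    have : l != i by apply: contraTneq ext => ->; apply: contraL oy; apply: extreme_even.
    move=> li; move: ext; rewrite /coface put_diff // => ext.
    move: (extreme_even ext); rewrite evij (negPf li) /= => /eqP lj.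
    by rewrite -lj.
  rewrite big_mkcond big_bool /= /in_range (extremeE (x i)).
  have lec : (x i <= c.*2)%N by rewrite -ltnS.
  have [x0|x_gt0] := posnP (x i); have [xm|xm] := ltnP (x i) c.*2.
  - by rewrite add0r andbT.
  - by move: xm; rewrite leqNgt x0 double_gt0 c_gt0.
  - by rewrite ltn_eqF //= andbF F2D.
  - by rewrite eqn_leq lec xm /= andbT addr0.
have qp : q != p by rewrite eq_sym.
have ev' i : ~~ odd (x i) = (i == q) || (i == p) by rewrite ev orbC.
pose T i := \sum_(b | ~~ odd (x i) && in_range b (x i)) (top_row (coface x i b))%:R : F.
have Tp : T p = (extreme (x q) && extreme (x p))%:R := term p q pq ev.
have Tq : T q = (extreme (x p) && extreme (x q))%:R := term q p qp ev'.
have -> : bound (fun y => (top_row y)%:R) x = \sum_i T i by [].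
rewrite (bigD1 p isT) (bigD1 q qp) /= Tp Tq andbC addrA F2D add0r.
apply: big1 => i /andP[ip iq].
by apply: big_pred0 => b; rewrite ev (negPf ip) (negPf iq).
Qed.

Lemma top_weight_antipode x :
  top_weight (antipode x) = top_weight x + (top_row x)%:R.
Proof.
rewrite /top_weight /top_row valid_antipode rank_antipode.
by case: (boolP (valid_row x)) => vx; rewrite ?mul0r ?addr0 // sgn_antipode // mulrDr mulr1.
Qed.

(** [top_weight] and its antipodal image add up to the cycle [top_row], so they have the same
    boundary. *)
Lemma bound_top_weight x : (0 < d)%N ->
  bound top_weight (antipode x) = bound top_weight x.
Proof.
move=> d_gt0; rewrite bound_antipode -[RHS]addr0 -(bound_top_row x d_gt0) -boundD.
by apply: eq_bound => i b _ _; rewrite top_weight_antipode.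
Qed.

Lemma bound_top_weight0 x : ~~ valid_row x -> bound top_weight x = 0.
Proof.
move=> nvx; apply: big1 => i _; apply: big1 => b /andP[ev inr].
rewrite /top_weight /top_row; case: (boolP (valid_row _)) => vy.
  by rewrite (valid_coface_row ev inr vy) in nvx.
by rewrite mul0r.
Qed.

(** Only the central cell [N] of a facet in direction 0 and its antipode are standard top cells, and
    the weight keeps one of them. *)
Lemma sum_top_weight_standard :
  \sum_x top_weight x * (standard x)%:R = 1 :> F.
Proof.
have lt_c : (c < c.*2.+1)%N by lia.
pose N : sphere := [ffun i => if i == ord0 then ord0 else Ordinal lt_c].
have oN i : odd (N i) = (i != ord0) by rewrite ffunE; case: eqP => //=; rewrite odd_c.
have rN : rank N = d.
  rewrite /rank (_ : [set _ | _] = [set~ ord0]); last by apply/setP=> i; rewrite !inE oN.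
  by rewrite cardsC1 card_ord.
have vN : valid_row N by apply/existsP; exists ord0; rewrite ffunE eqxx extremeE.
have sN : standard N.
  apply/forallP=> i; rewrite rN oN ffunE; case: (eqVneq i ord0) => [->//|i0].
  have i_gt0 : (0 < i)%N by rewrite lt0n.
  by rewrite i_gt0 -ltnS ltn_ord /=.
have snN : standard (antipode N) by rewrite standard_antipode.
have stdP x : top_row x -> standard x -> x = N \/ x = antipode N.
  case/andP=> vx /eqP rx /forallP st.
  have xc i : i != ord0 -> x i = Ordinal lt_c.
    move=> i0; apply: ord_inj => /=; have := st i.
    have i_gt0 : (0 < i)%N by rewrite lt0n.
    by rewrite rx i_gt0 -ltnS ltn_ord => /eqP.
  case/existsP: vx => i; case: (eqVneq i ord0) => [->|i0 /extreme_even]; last first.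
    by rewrite xc //= odd_c.
  case/orP=> /eqP x0; [left|right]; apply/ffunP=> l; rewrite !ffunE.
    by case: eqVneq => [->|/xc].
  case: eqVneq => [->|/xc->]; apply: ord_inj; rewrite rev_coordE ?x0 /=; lia.
have twN : top_weight N = 1.
  rewrite /top_weight /top_row vN rN eqxx mul1r /sgn rN ltnn.
  have -> : inord 0 = ord0 :> 'I_d.+1 by apply: ord_inj; rewrite inordK.
  by rewrite ffunE eqxx /= (ltn_eqF c_gt0) c_gt0.
have twnN : top_weight (antipode N) = 0.
  by rewrite top_weight_antipode twN /top_row vN rN eqxx F2D.
rewrite (bigD1 N) //= twN sN mulr1 big1 ?addr0 // => x xN.
case: (boolP (top_row x)) => [tx|ntx]; last by rewrite /top_weight (negPf ntx) !mul0r.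
case: (boolP (standard x)) => [sx|nsx]; last by rewrite mulr0.
by case: (stdP x tx sx) xN => [->|->]; rewrite ?eqxx // twnN mul0r.
Qed.

End Sphere.

Section MonomialShift.
Variables (F : comNzRingType) (k : nat).

Lemma mcoeff_mulX (p : mpoly k F) (m : multinom k) (l : 'I_k) :
  mcoeff m (p * mpolyX F (mnm1 l)) =
  if (0 < m l)%N then mcoeff (mnm_sub m (mnm1 l)) p else 0.
Proof.
case: ifP => [m_gt0|/negbT m_eq0].
  rewrite -[X in mcoeff X]( _ : mnm_add (mnm1 l) (mnm_sub m (mnm1 l)) = m) ?mcoeffMX //.
  apply/mnmP=> i; rewrite mnmDE mnmBE mnm1E; case: eqP => [<-|_] //=; lia.
apply: memN_msupp_eq0; rewrite (perm_mem (msuppMX _ _)).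
apply/mapP=> -[m' _ def_m]; move: m_eq0.
by rewrite def_m mnmDE mnm1E eqxx.
Qed.

End MonomialShift.

(** * Products of spheres and equivariant labels *)

Section Product.
Variables (c d k : nat).
Hypothesis odd_c : odd c.
Local Notation sphere := (cell c 'I_d.+1).
Local Notation pcell := (cell c ('I_k * 'I_d.+1)%type).
Implicit Types (u v w : pcell) (l : 'I_k).

Definition row v l : sphere := [ffun i => v (l, i)].
Definition flip l v : pcell :=
  [ffun p => if p.1 == l then rev_ord (v p) else v p].
Definition valid v := [forall l, valid_row (row v l)].
Definition degrees v : multinom k := Multinom [tuple rank (row v l) | l < k].

Lemma flipK l : involutive (flip l).
Proof.
by move=> v; apply/ffunP=> p; rewrite !ffunE; case: eqP => // _; rewrite rev_ordK.
Qed.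

Lemma row_flip l v l' :
  row (flip l v) l' = if l' == l then antipode (row v l') else row v l'.
Proof. by case: eqP => ll; apply/ffunP=> i; rewrite !ffunE /= ?ll ?eqxx //; case: eqP. Qed.

Lemma valid_flip l v : valid (flip l v) = valid v.
Proof. by apply: eq_forallb => l'; rewrite row_flip; case: eqP; rewrite // valid_antipode. Qed.

Lemma row_face l i b v l' :
  row (face v (l, i) b) l' = if l' == l then face (row v l) i b else row v l'.
Proof.
apply/ffunP=> i'; case: eqP => [->|nl]; rewrite !ffunE xpair_eqE /= ?eqxx //=.
by rewrite (_ : (l' == l) = false) //; apply/eqP.
Qed.

Lemma row_coface l i b v l' :
  row (coface v (l, i) b) l' = if l' == l then coface (row v l) i b else row v l'.
Proof.
apply/ffunP=> i'; case: eqP => [->|nl]; rewrite !ffunE xpair_eqE /= ?eqxx //=.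
by rewrite (_ : (l' == l) = false) //; apply/eqP.
Qed.

Lemma valid_face v p b : odd (v p) -> valid v -> valid (face v p b).
Proof.
case: p => l i ov /forallP vv; apply/forallP=> l'; rewrite row_face.
by case: eqP => // _; apply: valid_face_row => //; rewrite ffunE.
Qed.

Lemma face_flip l v p b : odd (v p) ->
  face (flip l v) p b = flip l (face v p (if p.1 == l then ~~ b else b)).
Proof.
move=> ov; apply/ffunP=> q; rewrite !ffunE; case: (eqVneq q p) => [->|//].
case: eqP => // _; apply: ord_inj; rewrite rev_coordE !shiftE ?odd_rev_coord //.
by rewrite rev_coordE; case: b; case: (v p) ov => a /=; lia.
Qed.

Lemma degreesE v l : degrees v l = rank (row v l).
Proof. exact: mnmE. Qed.

Lemma degrees_flip l v : degrees (flip l v) = degrees v.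
Proof.
apply/mnmP=> l'; rewrite !degreesE row_flip.
by case: eqP => // _; rewrite rank_antipode.
Qed.

Lemma degrees_face v l i b : odd (v (l, i)) ->
  degrees (face v (l, i) b) = mnm_sub (degrees v) (mnm1 l).
Proof.
move=> ov; apply/mnmP=> l'; rewrite mnmBE mnm1E !degreesE row_face.
case: (eqVneq l' l) => [->|_]; last by rewrite subn0.
by rewrite (rank_face (x := row v l) (i := i) b) ?ffunE // subn1.
Qed.

Variables (F : comNzRingType) (pcharF : 2 \in [pchar F]).
Let F2D := addrr_pchar2 pcharF.
Implicit Types (R B lam : pcell -> F).

Definition invariant R := forall l v, valid v -> R (flip l v) = R v.
Definition closed R := forall v, valid v -> cobd R v = 0.
(* Labels represent classes in the cohomology of the quotient of the product of
   spheres by the antipodes: [label al] stands for the sum of [t_l], l in [al]. *)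
Definition label (al : {set 'I_k}) lam :=
  forall l v, valid v -> lam (flip l v) = lam v + (l \in al)%:R.
(** Cohomology is taken in the quotient by the antipodes, hence the invariance of [B]. *)
Definition homologous R R' := exists B,
  invariant B /\ forall v, valid v -> R v = R' v + cobd B v.

Lemma cobd_rows R v :
  cobd R v = \sum_l \sum_(i | odd (row v l i)) \sum_b R (face v (l, i) b).
Proof.
rewrite (eq_bigr (fun l => \sum_(i | odd (v (l, i))) \sum_b R (face v (l, i) b))).
  by rewrite pair_big_dep /=; apply: eq_big => [[]|[]].
by move=> l _; apply: eq_bigl => i; rewrite ffunE.
Qed.

Lemma eq_cobd_valid R R' v : valid v ->
  (forall u, valid u -> R u = R' u) -> cobd R v = cobd R' v.
Proof. by move=> vv eqR; apply: eq_cobd => x b ov; apply/eqR/valid_face. Qed.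

Lemma cobd_flip R l v : cobd R (flip l v) = cobd (fun u => R (flip l u)) v.
Proof.
rewrite /cobd; apply: eq_big => [p|p].
  by rewrite ffunE; case: eqP => // _; rewrite odd_rev_coord.
rewrite ffunE; have -> : odd (if p.1 == l then rev_ord (v p) else v p) = odd (v p).
  by case: eqP => // _; rewrite odd_rev_coord.
move=> ov; case: (eqVneq p.1 l) => pl.
  rewrite [RHS](reindex_inj negb_inj); apply: eq_bigr => b _.
  by rewrite (face_flip _ _ ov) pl eqxx.
by apply: eq_bigr => b _; rewrite face_flip // (negPf pl).
Qed.

Lemma invariant_cobd R : invariant R -> invariant (cobd R).
Proof.
move=> invR l v vv; rewrite cobd_flip; apply: eq_cobd_valid => // u vu.
exact: invR.
Qed.

Lemma closed_cobd R : closed (cobd R).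
Proof. by move=> v _; apply: cobd_cobd. Qed.

(** A flip adds a constant to the label, and a constant contributes a multiple of the coboundary of
    [R], which is zero. *)
Lemma invariant_cup al lam R : label al lam -> invariant R -> closed R ->
  invariant (cobd (fun u => lam u * R u)).
Proof.
move=> labl invR clR l v vv; rewrite cobd_flip.
rewrite (eq_cobd_valid (R' := fun u => lam u * R u + (l \in al)%:R * R u)) //.
  by rewrite cobdD cobdZ clR // mulr0 addr0.
by move=> u vu; rewrite labl // invR // mulrDl.
Qed.

Lemma homologous_refl R : homologous R R.
Proof.
exists (fun=> 0); split=> // v _; rewrite cobd0 addr0 //.
Qed.

Lemma homologous_cup al lam lam' R R' :
  label al lam -> label al lam' -> invariant R -> homologous R R' ->
  homologous (cobd (fun u => lam u * R u)) (cobd (fun u => lam' u * R' u)).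
Proof.
move=> lab lab' invR [B [invB eqB]].
(* The first term changes the label; it is invariant since two labels of the same set change alike.
   The other two change the representative: neither need be invariant alone, but a flip adds the
   same multiple of [cobd B] to both. *)
exists (fun v => (lam v + lam' v) * R v + (lam' v * cobd B v + cobd (fun u => lam' u * B u) v)).
split=> [l v vv|v vv].
  rewrite lab // lab' // invR // addrACA F2D addr0; congr (_ + _).
  have -> : cobd (fun u => lam' u * B u) (flip l v) =
      cobd (fun u => lam' u * B u) v + (l \in al)%:R * cobd B v.
    rewrite cobd_flip -cobdZ -cobdD; apply: eq_cobd_valid => // u vu.
    by rewrite lab' // invB // mulrDl.
  by rewrite invariant_cobd // mulrDl addrACA F2D addr0.
rewrite !cobdD cobd_cobd // addr0 -!cobdD.
apply: eq_cobd_valid => // u vu.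
rewrite addrCA -mulrDr -[R' u + _]eqB // mulrDl -addrA F2D addr0 //.
Qed.

(* The polynomial [p] as an explicit cocycle; degrees are per sphere. *)
Definition monomial_cochain (p : mpoly k F) v : F :=
  mcoeff (degrees v) p * \prod_l (standard (row v l))%:R.

Lemma monomial_cochain_face p v l i b : odd (row v l i) ->
  monomial_cochain p (face v (l, i) b) =
  mcoeff (mnm_sub (degrees v) (mnm1 l)) p *
  (\prod_(l' | l' != l) (standard (row v l'))%:R) *
  (standard (face (row v l) i b))%:R.
Proof.
rewrite ffunE => ov; rewrite /monomial_cochain degrees_face // -mulrA; congr (_ * _).
rewrite (bigD1 l) //= row_face eqxx mulrC; congr (_ * _).
by apply: eq_bigr => l' /negPf nl; rewrite row_face nl.
Qed.

Lemma invariant_monomial p : invariant (monomial_cochain p).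
Proof.
move=> l v vv; rewrite /monomial_cochain degrees_flip; congr (_ * _).
apply: eq_bigr => l' _; rewrite row_flip; case: eqP => // _.
by rewrite standard_antipode.
Qed.

Lemma closed_monomial p : closed (monomial_cochain p).
Proof.
move=> v vv; rewrite cobd_rows big1 // => l _.
under eq_bigr => i ov do under eq_bigr => b _ do rewrite monomial_cochain_face //.
under eq_bigr do rewrite -mulr_sumr.
rewrite -mulr_sumr.
have := cobd_standard odd_c pcharF (row v l); rewrite /cobd => -> //.
by rewrite mulr0.
Qed.

(** Only row [l] contributes, by [cobd_sgn_standard]; in the directions of the other rows the label
    is constant and the standard cells form a cocycle. *)
Lemma cup_monomial l p v : valid v ->
  cobd (fun u => sgn F (row u l) * monomial_cochain p u) v =
  monomial_cochain (p * mpolyX F (mnm1 l)) v.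
Proof.
move=> vv; rewrite cobd_rows (bigD1 l) //= [X in _ + X]big1 ?addr0 => [|l' nl].
  under eq_bigr => i ov do under eq_bigr => b _ do
    rewrite row_face eqxx monomial_cochain_face // mulrCA.
  under eq_bigr do rewrite -mulr_sumr.
  rewrite -mulr_sumr.
  have := cobd_sgn_standard odd_c pcharF (forallP vv l); rewrite /cobd => ->.
  rewrite /monomial_cochain mcoeff_mulX degreesE.
  rewrite [X in _ = _ * X](bigD1 l) //=.
  case: ifP => _; first by rewrite mul1r -mulrA [X in _ * X]mulrC.
  by rewrite !mul0r mulr0.
rewrite eq_sym in nl.
under eq_bigr => i ov do under eq_bigr => b _ do
  rewrite row_face (negPf nl) monomial_cochain_face // mulrA.
under eq_bigr do rewrite -mulr_sumr.
rewrite -mulr_sumr.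
have := cobd_standard odd_c pcharF (row v l'); rewrite /cobd => -> //.
by rewrite mulr0.
Qed.

(** A reference label for each set, whose products with monomial cochains are computed exactly. *)
Definition model (al : {set 'I_k}) v : F := \sum_(l in al) sgn F (row v l).

Lemma label_sgn l : label [set l] (fun v => sgn F (row v l)).
Proof.
move=> l' v vv; rewrite row_flip inE.
case: (eqVneq l' l) => _; last by rewrite addr0.
by rewrite sgn_antipode //; exact: (forallP vv).
Qed.

Lemma label_model al : label al (model al).
Proof.
move=> l v vv; rewrite /model.
under eq_bigr do rewrite label_sgn // inE.
rewrite big_split /=; congr (_ + _).
case: (boolP (l \in al)) => lal; last first.
  by rewrite big1 // => l' l'al; case: eqP => // ll; rewrite ll l'al in lal.
rewrite (bigD1 l) //= eqxx big1 ?addr0 // => l' /andP[_ nl].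
by rewrite eq_sym (negPf nl).
Qed.

Definition linear_form (al : {set 'I_k}) : mpoly k F := \sum_(l in al) mpolyX F (mnm1 l).

Lemma cup_model al p v : valid v ->
  cobd (fun u => model al u * monomial_cochain p u) v =
  monomial_cochain (p * linear_form al) v.
Proof.
move=> vv.
rewrite (eq_cobd (R' := fun u => \sum_(l <- enum al)
    (sgn F (row u l) * monomial_cochain p u))); last first.
  by move=> x b _; rewrite /model mulr_suml big_enum.
rewrite cobd_sum; under eq_bigr do rewrite cup_monomial //.
rewrite /monomial_cochain /linear_form big_enum mulr_sumr raddf_sum mulr_suml.
by [].
Qed.

(** Pairing with the fundamental class of the quotient: the product of the weights keeps one top
    cell of each orbit of the flips. *)
Definition evaluation R : F :=
  \sum_v (\prod_l top_weight F (row v l)) * R v.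

Lemma bound_rows R v : bound R v =
  \sum_l \sum_i \sum_(b | ~~ odd (row v l i) && in_range b (row v l i))
    R (coface v (l, i) b).
Proof.
by rewrite pair_bigA; apply: eq_bigr => -[l i] _; rewrite /row ffunE.
Qed.

(** After Stokes, the term of row [l] contains the boundary of a half sphere, invariant under
    [flip l], and weights of the other rows only; so cells exchanged by [flip l] cancel. *)
Lemma evaluation_cobd B : (0 < d)%N -> invariant B -> evaluation (cobd B) = 0.
Proof.
move=> d_gt0 invB; rewrite /evaluation sum_cobd.
pose rest l v := \prod_(l' | l' != l) top_weight F (row v l').
have -> : \sum_u bound (fun v => \prod_l top_weight F (row v l)) u * B u =
    \sum_u \sum_l bound (top_weight F (d:=d)) (row u l) * rest l u * B u.
  apply: eq_bigr => u _; rewrite -mulr_suml; congr (_ * _).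
  rewrite bound_rows; apply: eq_bigr => l _; rewrite mulr_suml.
  apply: eq_bigr => i _; rewrite mulr_suml; apply: eq_bigr => b _.
  rewrite (bigD1 l) //= row_coface eqxx; congr (_ * _).
  by apply: eq_bigr => l' /negPf nl; rewrite row_coface nl.
rewrite exchange_big big1 // => l _ /=.
have inv0 u : ~~ valid u -> bound (top_weight F (d:=d)) (row u l) * rest l u = 0.
  rewrite negb_forall => /existsP[l' nv].
  case: (eqVneq l' l) nv => [->|nl] nv; first by rewrite bound_top_weight0 ?mul0r.
  by rewrite /rest (bigD1 l') //= {2}/top_weight /top_row (negPf nv) !mul0r mulr0.
apply: (sum_involution pcharF (flipK l)) => [u|u fu].
  case: (boolP (valid u)) => vu; last first.
    by rewrite [X in X * _ = _]inv0 ?valid_flip // [X in _ = X * _]inv0 // !mul0r.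
  rewrite invB // row_flip eqxx bound_top_weight //; congr (_ * _ * _).
  by apply: eq_bigr => l' /negPf nl; rewrite row_flip nl.
rewrite inv0 ?mul0r //; apply/forallPn; exists l; apply/negP=> vl.
by have := antipode_neq odd_c vl; rewrite -{2}fu row_flip eqxx eqxx.
Qed.

Definition top_degrees : multinom k := Multinom [tuple d | l < k].

(** Cells of other degrees have weight zero, and the rest factors into one sum per row, each equal
    to one. *)
Lemma evaluation_monomial p : evaluation (monomial_cochain p) = mcoeff top_degrees p.
Proof.
have -> : evaluation (monomial_cochain p) =
    \sum_v mcoeff top_degrees p * \prod_l (top_weight F (row v l) * (standard (row v l))%:R).
  apply: eq_bigr => v _; rewrite /monomial_cochain.
  case: (eqVneq (degrees v) top_degrees) => [->|ndeg].
    by rewrite mulrCA -big_split.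
  have [l nl] : exists l, rank (row v l) != d.
    apply/existsP; apply: contraNT ndeg; rewrite negb_exists => /forallP rk.
    apply/eqP/mnmP=> l; rewrite degreesE mnmE; apply/eqP.
    by have := rk l; rewrite negbK.
  have tw0 : top_weight F (row v l) = 0.
    by rewrite /top_weight /top_row (negPf nl) andbF mul0r.
  by rewrite (bigD1 l) //= tw0 !mul0r [X in _ * X](bigD1 l) //= tw0 !mul0r mulr0.
rewrite -mulr_sumr -[RHS]mulr1; congr (_ * _).
pose cut (v : pcell) : {ffun 'I_k -> sphere} := [ffun l => row v l].
pose glue (f : {ffun 'I_k -> sphere}) : pcell := [ffun p => f p.1 p.2].
rewrite (reindex glue) /=; last first.
  exists cut => v _; first by apply/ffunP=> l; apply/ffunP=> i; rewrite !ffunE.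
  by apply/ffunP=> -[l i]; rewrite !ffunE.
rewrite -[RHS](_ : \prod_(l : 'I_k) \sum_(x : sphere) top_weight F x * (standard x)%:R = 1).
  rewrite bigA_distr_bigA; apply: eq_bigr => f _; apply: eq_bigr => l _.
  suff -> : row (glue f) l = f l by [].
  by apply/ffunP=> i; rewrite !ffunE.
by rewrite big1 // => l _; rewrite sum_top_weight_standard.
Qed.

Lemma evaluation_homologous R R' : (0 < d)%N ->
  homologous R R' -> evaluation R = evaluation R'.
Proof.
move=> d_gt0 [B [invB eqB]]; rewrite -[RHS]addr0 -(evaluation_cobd d_gt0 invB).
rewrite /evaluation -big_split; apply: eq_bigr => v _ /=; rewrite -mulrDr.
case: (boolP (valid v)) => vv; first by rewrite eqB.
move: vv; rewrite negb_forall => /existsP[l nv].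
by rewrite (bigD1 l) //= {1 3}/top_weight /top_row (negPf nv) !mul0r.
Qed.

End Product.

(** * Cochains vanishing on a closed cell *)

Section Local.
Variables (c d k : nat).
Hypothesis odd_c : odd c.
Local Notation pcell := (cell c ('I_k * 'I_d.+1)%type).
Implicit Types (u v w : pcell).

(* [u] is a face of [w]. *)
Definition below u w := forall p, u p = w p \/
  [/\ odd (w p), ~~ odd (u p), (u p <= (w p).+1)%N & (w p <= (u p).+1)%N].

Lemma below_refl w : below w w.
Proof. by move=> p; left. Qed.

Lemma below_face v w p b : odd (v p) -> below v w -> below (face v p b) w.
Proof.
clear odd_c; move=> ov vw q; case: (eqVneq q p) => [->|qp]; last by rewrite /face put_diff.
have vwp : v p = w p by case: (vw p) => // -[_]; rewrite ov.
right; rewrite /face put_same odd_shift // -vwp ov shiftE //; split=> //.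
  by case: b; lia.
by case: b; lia.
Qed.

Lemma valid_below v w : below v w -> valid w -> valid v.
Proof.
move=> vw /forallP vl; apply/forallP=> l; have /existsP[i ext] := vl l.
apply/existsP; exists i; move: ext; rewrite !ffunE => ext.
by case: (vw (l, i)) => [->//|[]]; rewrite (negPf (extreme_even odd_c ext)).
Qed.

Variables (F : comNzRingType) (pcharF : 2 \in [pchar F]).
Implicit Types (R lam : pcell -> F).

Definition vanishing w R := forall u, below u w -> R u = 0.
Definition constant_below w lam := forall u, below u w -> lam u = lam w.

Lemma vanishing_cobd w R : vanishing w R -> vanishing w (cobd R).
Proof.
move=> vR u uw; rewrite -(cobd0 F u); apply: eq_cobd => p b ov.
by apply/vR/below_face.
Qed.

Lemma vanishing_mul w lam R :
  vanishing w R -> vanishing w (fun u => lam u * R u).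
Proof. by move=> vR u uw; rewrite vR // mulr0. Qed.

(** A constant label comes out of the coboundary and leaves the coboundary of the closed [R]. This
    is how a function of constant sign kills the product near a cell. *)
Lemma vanishing_cup w lam R : valid w -> closed R -> constant_below w lam ->
  vanishing w (cobd (fun u => lam u * R u)).
Proof.
move=> vw clR clam u uw.
rewrite (eq_cobd (R' := fun v => lam w * R v)); last first.
  by move=> p b ov; rewrite clam //; apply: below_face.
by rewrite cobdZ clR ?mulr0 //; apply: valid_below vw.
Qed.

End Local.

(** * Exchanging two spheres *)

Section Swap.
Variables (c d k : nat).
Hypothesis odd_c : odd c.
Variables (x y : 'I_k).
Hypothesis neq_xy : x != y.
Local Notation pcell := (cell c ('I_k * 'I_d.+1)%type).
Local Notation sphere := (cell c 'I_d.+1).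
Implicit Types (u v w : pcell) (l : 'I_k).

Definition swap v : pcell := [ffun p => v (tperm x y p.1, p.2)].
Definition swap_set (al : {set 'I_k}) := [set l | tperm x y l \in al].
Definition diagonal_cell v := (row v x == row v y) || (row v x == antipode (row v y)).
(* Antipode-invariant; [side] thus orders two rows that are distinct up to sign. *)
Definition key (s : sphere) := minn (enum_rank s) (enum_rank (antipode s)).
Definition side v := (key (row v x) < key (row v y))%N.

Lemma swapK : involutive swap.
Proof. by move=> v; apply/ffunP=> -[l i]; rewrite !ffunE /= tpermK. Qed.

Lemma row_swap v l : row (swap v) l = row v (tperm x y l).
Proof. by apply/ffunP=> i; rewrite !ffunE. Qed.

Lemma valid_swap v : valid (swap v) = valid v.
Proof.
apply/forallP/forallP => vv l; first by rewrite -(tpermK x y l) -row_swap.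
by rewrite row_swap.
Qed.

Lemma swap_flip l v : swap (flip l v) = flip (tperm x y l) (swap v).
Proof.
apply/ffunP=> -[l' i]; rewrite !ffunE /=.
by rewrite -(inj_eq (@perm_inj _ (tperm x y))) tpermK.
Qed.

Lemma side_flip l v : side (flip l v) = side v.
Proof.
have kA s : key (antipode s) = key s by rewrite /key antipodeK minnC.
rewrite /side !row_flip.
by case: (x == l); case: (y == l); rewrite ?kA.
Qed.

(** A key determines a row up to the antipode, so off the diagonal the two keys differ. *)
Lemma side_swap v : ~~ diagonal_cell v -> side (swap v) = ~~ side v.
Proof.
rewrite negb_or => /andP[nd nd'].
rewrite /side !row_swap tpermL tpermR -leqNgt [RHS]leq_eqVlt.
suff -> : (key (row v y) == key (row v x)) = false by [].
apply: contraNF nd => /eqP; rewrite /key /minn.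
set a := row v x in nd' *; set b := row v y in nd' *.
have na : antipode a != b.
  by apply: contraNneq nd' => <-; rewrite antipodeK.
case: ifP => _; case: ifP => _ /ord_inj/enum_rank_inj eqab.
- by rewrite eqab.
- by rewrite eqab eqxx in na.
- by rewrite -eqab eqxx in nd'.
- by rewrite -(inj_eq (inv_inj (@antipodeK c d))) eqab.
Qed.

Variables (F : comNzRingType) (pcharF : 2 \in [pchar F]).
Let F2D := addrr_pchar2 pcharF.
Implicit Types (R lam X : pcell -> F) (al : {set 'I_k}).

Definition symmetric_cochain R := forall v, valid v -> R (swap v) = R v.
Definition diagonal_vanishing R :=
  forall v, valid v -> diagonal_cell v -> vanishing v R.

Lemma cobd_swap R v : cobd R (swap v) = cobd (fun u => R (swap u)) v.
Proof.
pose h (p : 'I_k * 'I_d.+1) := (tperm x y p.1, p.2).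
have hK : involutive h by case=> l i; rewrite /h /= tpermK.
rewrite [RHS](reindex_inj (inv_inj hK)).
apply: eq_big => [p|p ov]; first by rewrite ffunE.
apply: eq_bigr => b _; congr R; apply/ffunP=> q; rewrite !ffunE.
have -> : ((tperm x y q.1, q.2) == h p) = (q == p) := inj_eq (inv_inj hK) q p.
by case: eqP.
Qed.

Lemma label_swap al lam :
  label al lam -> label (swap_set al) (fun v => lam (swap v)).
Proof.
by move=> lab l v vv; rewrite swap_flip lab ?valid_swap // inE.
Qed.

Lemma symmetric_cup lam R : symmetric_cochain lam -> symmetric_cochain R ->
  symmetric_cochain (cobd (fun u => lam u * R u)).
Proof.
move=> sl sR v vv; rewrite cobd_swap; apply: eq_cobd_valid => // u vu.
by rewrite sl // sR.
Qed.

Section Pair.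
Variables (X R : pcell -> F).
Let Y v := X (swap v).

(* [pair_cup] multiplies by the classes of [X] and of its swap [Y].  The second
   summand makes the result symmetric: [d diagonal_part] is the difference of
   the products in the two orders, and [side] is exchanged with its complement by
   the swap. *)
Definition diagonal_part v :=
  cobd (fun u => X u * Y u * R u) v +
  (X v * cobd (fun u => Y u * R u) v + Y v * cobd (fun u => X u * R u) v).

Definition pair_cup v :=
  cobd (fun u => Y u * cobd (fun u => X u * R u) u) v +
  cobd (fun u => (side u)%:R * diagonal_part u) v.

(** A flip adds constants [e], [e'] to [X], [Y]. The multiples of the coboundaries of [X R] and
    [Y R] so created arise once from the triple product and once from the other terms, and cancel;
    the constant [e * e'] comes with [cobd R], which is zero. *)
Lemma invariant_diagonal_part al : label al X -> invariant R -> closed R ->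
  invariant diagonal_part.
Proof.
move=> lX invR clR l v vv; have lY := label_swap lX.
have cup_flip lam be : label be lam -> cobd (fun u => lam u * R u) (flip l v) =
    cobd (fun u => lam u * R u) v.
  by move=> ll; apply: (invariant_cup odd_c ll).
rewrite /diagonal_part (cup_flip _ _ lX) (cup_flip _ _ lY) lX // [Y _]lY //.
set e := _%:R; set e' := _%:R.
have -> : cobd (fun u => X u * Y u * R u) (flip l v) =
    cobd (fun u => X u * Y u * R u) v +
    (e * cobd (fun u => Y u * R u) v + e' * cobd (fun u => X u * R u) v).
  rewrite cobd_flip //; transitivity (cobd (fun u => X u * Y u * R u +
      (e * (Y u * R u) + e' * (X u * R u) + e * e' * R u)) v).
    apply: eq_cobd_valid => // u vu.
    have eX : X (flip l u) = X u + e := lX l u vu.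
    have eY : Y (flip l u) = Y u + e' := lY l u vu.
    by rewrite eX eY invR //; ring.
  by rewrite !cobdD !cobdZ clR // mulr0 addr0.
rewrite -/(Y v); set A := cobd _ v; set B := cobd _ v; set B' := cobd _ v.
transitivity (A + (X v * B + Y v * B') + (e * B + e * B) + (e' * B' + e' * B')).
  by ring.
by rewrite !F2D !addr0.
Qed.

Lemma cobd_diagonal_part v : closed R -> valid v ->
  cobd diagonal_part v =
  cobd (fun u => X u * cobd (fun u => Y u * R u) u) v +
  cobd (fun u => Y u * cobd (fun u => X u * R u) u) v.
Proof. by move=> _ _; rewrite !cobdD cobd_cobd // add0r. Qed.

Lemma vanishing_pair_cup w : vanishing w R -> vanishing w pair_cup.
Proof.
move=> vR u uw; rewrite /pair_cup.
have vc lam : vanishing w (cobd (fun u => lam u * R u)).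
  exact/vanishing_cobd/vanishing_mul.
rewrite (vanishing_cobd (vanishing_mul Y (vc X))) // add0r.
apply: (vanishing_cobd (w := w)) => // v vw.
rewrite /diagonal_part (vc (fun u => X u * Y u)) // !vc //.
by rewrite !mulr0 !addr0 mulr0.
Qed.

(** A constant [X] makes the coboundary of [X R] vanish, and the first two terms of [diagonal_part]
    become equal; so the symmetrising summand does not spoil the vanishing. *)
Lemma vanishing_pair_cup_constant w : valid w -> closed R ->
  constant_below w X -> vanishing w pair_cup.
Proof.
move=> vw clR cX u uw; rewrite /pair_cup.
have vX := vanishing_cup odd_c vw clR cX.
rewrite (vanishing_cobd (vanishing_mul Y vX)) // add0r.
apply: (vanishing_cobd (w := w)) => // v vw'.
rewrite /diagonal_part vX // mulr0 addr0.
rewrite (eq_cobd (R' := fun u => X w * (Y u * R u))); last first.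
  by move=> p b ov; rewrite cX ?mulrA //; apply: below_face.
by rewrite cobdZ cX // F2D mulr0.
Qed.

Lemma vanishing_pair_cup_swap w : valid w -> closed R ->
  constant_below w Y -> vanishing w pair_cup.
Proof.
move=> vw clR cY u uw; rewrite /pair_cup.
have vY := vanishing_cup odd_c vw clR cY.
have cobdY (S : pcell -> F) v : below v w ->
    cobd (fun u => Y u * S u) v = Y w * cobd S v.
  move=> vw'; rewrite -cobdZ; apply: eq_cobd => p b ov.
  by rewrite cY //; apply: below_face.
rewrite cobdY // cobd_cobd // mulr0 add0r.
apply: (vanishing_cobd (w := w)) => // v vw'.
rewrite /diagonal_part vY // mulr0 add0r.
rewrite (eq_cobd (R' := fun u => Y u * (X u * R u))); last first.
  by move=> p b ov; rewrite mulrCA mulrA.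
by rewrite cobdY // cY // F2D mulr0.
Qed.

End Pair.

(** On diagonal cells [side] is not exchanged with its complement; there [diagonal_vanishing R]
    makes [diagonal_part] zero. *)
Lemma symmetric_pair_cup X R : symmetric_cochain R -> closed R ->
  diagonal_vanishing R -> symmetric_cochain (pair_cup X R).
Proof.
move=> sR clR dR v vv.
pose Y u := X (swap u).
pose cX := cobd (fun u => X u * R u); pose cY := cobd (fun u => Y u * R u).
have cXs u : valid u -> cX (swap u) = cY u.
  move=> vu; rewrite /cX cobd_swap; apply: eq_cobd_valid => // u' vu'.
  by rewrite sR.
have cYs u : valid u -> cY (swap u) = cX u.
  by move=> vu; rewrite -cXs ?valid_swap // swapK.
have Hs u : valid u -> diagonal_part X R (swap u) = diagonal_part X R u.
  move=> vu; rewrite /diagonal_part -/Y -/cX -/cY cXs // cYs // swapK.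
  rewrite [X in _ + X]addrC; congr (_ + _).
  rewrite cobd_swap; apply: eq_cobd_valid => // u' vu'.
  by rewrite sR // swapK [X in X * _]mulrC.
rewrite /pair_cup !cobd_swap.
have -> : cobd (fun u => X (swap (swap u)) * cX (swap u)) v = cobd (fun u => X u * cY u) v.
  by apply: eq_cobd_valid => // u vu; rewrite swapK cXs.
have -> : cobd (fun u => (side (swap u))%:R * diagonal_part X R (swap u)) v =
    cobd (fun u => (side u)%:R * diagonal_part X R u + diagonal_part X R u) v.
  apply: eq_cobd_valid => // u vu.
  rewrite Hs //; case: (boolP (diagonal_cell u)) => du; last first.
    by rewrite side_swap //; case: side; rewrite ?mul1r ?mul0r ?F2D ?add0r.
  suff -> : diagonal_part X R u = 0 by rewrite !mulr0 addr0.
  have vR := dR u vu du.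
  have vc lam : cobd (fun u => lam u * R u) u = 0.
    by apply: (vanishing_cobd (vanishing_mul lam vR)) => //; apply: below_refl.
  by rewrite /diagonal_part (vc (fun u => X u * Y u)) !vc !mulr0 !addr0.
rewrite [X in _ + X]cobdD cobd_diagonal_part // -/Y -/cX -/cY.
set a := cobd _ v; set h := cobd _ v; set b := cobd _ v.
transitivity (b + h + (a + a)); first by ring.
by rewrite F2D addr0.
Qed.

Definition tame (p : mpoly k F) R :=
  [/\ invariant R, closed R & homologous R (monomial_cochain p)].

Lemma tame_cup al lam p R : label al lam -> tame p R ->
  tame (p * linear_form F al) (cobd (fun u => lam u * R u)).
Proof.
move=> lab [invR clR homR]; split.
- exact: (invariant_cup odd_c lab).
- exact: closed_cobd.
have labm := label_model (d := d) odd_c pcharF al.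
have [B [invB eqB]] := homologous_cup odd_c pcharF lab labm invR homR.
by exists B; split=> // v vv; rewrite eqB // cup_model.
Qed.

(** The symmetrising summand is the coboundary of an invariant cochain, so the class is that of the
    plain product. *)
Lemma tame_pair_cup al X p R : label al X -> tame p R ->
  tame (p * linear_form F al * linear_form F (swap_set al)) (pair_cup X R).
Proof.
move=> lX tR; have [invR clR _] := tR.
have [inv2 cl2 [B [invB eqB]]] := tame_cup (label_swap lX) (tame_cup lX tR).
have invH : invariant (fun u => (side u)%:R * diagonal_part X R u).
  by move=> l v vv; rewrite side_flip (invariant_diagonal_part lX).
split.
- move=> l v vv; rewrite /pair_cup; congr (_ + _); first exact: inv2.
  exact: (invariant_cobd odd_c invH).
- move=> v vv; rewrite [LHS]cobdD -[RHS]addr0.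
  congr (_ + _); exact: cobd_cobd.
exists (fun u => B u + (side u)%:R * diagonal_part X R u); split.
  by move=> l v vv; rewrite invB // invH.
by move=> v vv; rewrite /pair_cup eqB // cobdD addrA.
Qed.

End Swap.

(** * Cells on which no label is constant *)

Section Unit.
Variables (c d k : nat).
Hypotheses (odd_c : odd c) (d_gt0 : (0 < d)%N).
Variables (F : comNzRingType) (pcharF : 2 \in [pchar F]).
Local Notation pcell := (cell c ('I_k * 'I_d.+1)%type).

Lemma tame_unit : tame (1 : mpoly k F) (@monomial_cochain c d k F 1).
Proof.
split; [exact: invariant_monomial | exact: closed_monomial |].
exact: homologous_refl.
Qed.

Lemma tame_evaluation p (R : pcell -> F) :
  tame p R -> evaluation R = mcoeff (top_degrees d k) p.
Proof.
by case=> _ _ hR; rewrite (evaluation_homologous odd_c pcharF d_gt0 hR) evaluation_monomial.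
Qed.

(** Multiplying the unit by all labels gives a cochain that vanishes wherever some label is
    constant. If this happened on every valid cell, its evaluation, the given coefficient, would be
    zero. *)
Theorem labels_separated (I : eqType) (s : seq I)
    (lam : I -> pcell -> F) (al : I -> {set 'I_k}) :
  (forall i, i \in s -> label (al i) (lam i)) ->
  mcoeff (top_degrees d k) (\prod_(i <- s) linear_form F (al i)) != 0 ->
  exists2 w : pcell, valid w &
    forall i, i \in s -> ~ constant_below w (lam i).
Proof.
move=> lab coef_neq0.
have [R [tR vR]] : exists R : pcell -> F,
    tame (\prod_(i <- s) linear_form F (al i)) R /\
    forall w i, valid w -> i \in s -> constant_below w (lam i) -> vanishing w R.
  elim: s lab {coef_neq0} => [|i s IHs] lab.
    by exists (monomial_cochain 1); rewrite big_nil; split => //; exact: tame_unit.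
  have [|R [tR vR]] := IHs; first by move=> j js; apply: lab; rewrite inE js orbT.
  have labi := lab i (mem_head _ _).
  exists (cobd (fun u => lam i u * R u)); split.
    by rewrite big_cons mulrC; apply: tame_cup.
  move=> w j vw; rewrite inE => /orP[/eqP->|js] cj.
    by apply: vanishing_cup => //; case: tR.
  by apply/vanishing_cobd/vanishing_mul; apply: vR js cj.
apply: contra_notP (elimN eqP coef_neq0) => nosep.
rewrite -(tame_evaluation tR) /evaluation big1 // => w _.
case: (boolP (valid w)) => vw.
  suff -> : R w = 0 by rewrite mulr0.
  apply: contra_notP nosep => Rw; exists w => // i si ci.
  by apply: Rw; apply: (vR w i vw si ci); exact: below_refl.
move: vw; rewrite negb_forall => /existsP[l nv].
by rewrite (bigD1 l) //= {1}/top_weight /top_row (negPf nv) !mul0r.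
Qed.

End Unit.

Section SwapTheorem.
Variables (c d k : nat).
Hypotheses (odd_c : odd c) (d_gt0 : (0 < d)%N).
Variables (x y : 'I_k).
Hypothesis neq_xy : x != y.
Variables (F : comNzRingType) (pcharF : 2 \in [pchar F]).
Let F2D := addrr_pchar2 pcharF.
Local Notation pcell := (cell c ('I_k * 'I_d.+1)%type).
Local Notation swap := (@swap c d k x y).
Local Notation diagonal_cell := (@diagonal_cell c d k x y).
Local Notation symmetric_cochain := (symmetric_cochain x y).
Local Notation diagonal_vanishing := (diagonal_vanishing x y).

(** The coefficient has t_x where the class of [mu1] is expected. [mu0] is multiplied first, to make
    everything vanish near the diagonal as [symmetric_pair_cup] requires; [mu1] itself is never
    multiplied, but is the defect of symmetry of the last label. *)
Theorem symmetric_labels_separated (I J : eqType) (s : seq I) (t : seq J)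
    (mu0 mu1 : pcell -> F)
    (lam : I -> pcell -> F) (al : I -> {set 'I_k})
    (X : J -> pcell -> F) (be : J -> {set 'I_k}) :
  label [set x; y] mu0 -> symmetric_cochain mu0 ->
  (forall v, valid v -> diagonal_cell v -> constant_below v mu0) ->
  label [set x; y] mu1 -> symmetric_cochain mu1 ->
  (forall i, i \in s -> label (al i) (lam i) /\ symmetric_cochain (lam i)) ->
  (forall j, j \in t -> label (be j) (X j)) ->
  mcoeff (top_degrees d k)
    (linear_form F [set x; y] * \prod_(i <- s) linear_form F (al i) *
     \prod_(j <- t) (linear_form F (be j) * linear_form F (swap_set x y (be j)))
     * linear_form F [set x]) != 0 ->
  exists w : pcell, [/\ valid w, ~ constant_below w mu0,
    ~ constant_below w mu1,
    forall i, i \in s -> ~ constant_below w (lam i) &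
    forall j, j \in t -> ~ constant_below w (X j) /\
      ~ constant_below w (fun v => X j (swap v))].
Proof.
move=> lab0 sym0 diag0 lab1 sym1 labs labt coef_neq0.
pose good p (R : pcell -> F) (L : pcell -> Prop) :=
  [/\ tame p R, symmetric_cochain R, diagonal_vanishing R &
      forall w, valid w -> L w -> vanishing w R].
have [R0 good0] : exists R, good (linear_form F [set x; y]) R (fun w => constant_below w mu0).
  have tame1 : tame (1 : mpoly k F) (@monomial_cochain c d k F 1) by apply: tame_unit.
  have cl1 : closed (@monomial_cochain c d k F 1) by case: tame1.
  exists (cobd (fun u => mu0 u * monomial_cochain 1 u)); split.
  - by rewrite -[linear_form _ _]mul1r; apply: tame_cup.
  - apply: symmetric_cup => // v vv; rewrite /monomial_cochain.
    rewrite (reindex_inj (@perm_inj _ (tperm x y))) /=; congr (_ * _).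
      rewrite !mcoeff1; congr (nat_of_bool _)%:R; apply/eqP/eqP => /mnmP deg0;
        apply/mnmP => l; rewrite degreesE mnmE ?row_swap.
        by have := deg0 (tperm x y l); rewrite degreesE row_swap tpermK mnmE.
      by have := deg0 (tperm x y l); rewrite degreesE mnmE.
    by apply: eq_bigr => l _; rewrite row_swap tpermK.
  - by move=> v vv dv; apply: vanishing_cup => //; apply: diag0.
  - by move=> w vw cw; apply: vanishing_cup.
have [R1 good1] : exists R, good (linear_form F [set x; y] * \prod_(i <- s) linear_form F (al i)) R
    (fun w => constant_below w mu0 \/ exists2 i, i \in s & constant_below w (lam i)).
  elim: s labs {coef_neq0} => [|i s IHs] labs.
    exists R0; rewrite big_nil mulr1; case: good0 => t0 s0 d0 v0; split=> // w vw.
    by case=> [|[]//]; apply: v0.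
  have [|R [tR sR dR vR]] := IHs; first by move=> j js; apply: labs; rewrite inE js orbT.
  have [labi symi] := labs i (mem_head _ _).
  exists (cobd (fun u => lam i u * R u)); split.
  - by rewrite big_cons [X in _ * X]mulrC mulrA; apply: tame_cup.
  - exact: symmetric_cup.
  - by move=> v vv dv; apply/vanishing_cobd/vanishing_mul/dR.
  move=> w vw [c0|[j]].
    by apply/vanishing_cobd/vanishing_mul/vR => //; left.
  rewrite inE => /orP[/eqP->|js] cj; first by apply: vanishing_cup => //; case: tR.
  by apply/vanishing_cobd/vanishing_mul/vR => //; right; exists j.
have [Q goodQ] : exists R, good (linear_form F [set x; y] * \prod_(i <- s) linear_form F (al i) *
    \prod_(j <- t) (linear_form F (be j) * linear_form F (swap_set x y (be j)))) R
    (fun w => [\/ constant_below w mu0, exists2 i, i \in s & constant_below w (lam i) |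
      exists2 j, j \in t & constant_below w (X j) \/
        constant_below w (fun v => X j (swap v))]).
  elim: t labt {coef_neq0} => [|j t IHt] labt.
    exists R1; rewrite big_nil mulr1; case: good1 => t0 s0 d0 v0; split=> // w vw.
    by case=> [?|?|[]//]; apply: v0 => //; [left|right].
  have [|R [tR sR dR vR]] := IHt; first by move=> i it; apply: labt; rewrite inE it orbT.
  have labj := labt j (mem_head _ _).
  have clR : closed R by case: tR.
  exists (pair_cup x y (X j) R); split.
  - rewrite big_cons; set A := _ * \prod_(i <- s) _; set B := \prod_(j <- t) _ in tR *.
    have -> : A * (linear_form F (be j) * linear_form F (swap_set x y (be j)) * B) =
      A * B * linear_form F (be j) * linear_form F (swap_set x y (be j)) by ring.
    exact: tame_pair_cup.
  - exact: symmetric_pair_cup.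
  - by move=> v vv dv; apply/vanishing_pair_cup/dR.
  move=> w vw [c0|ci|[i]].
  - by apply/vanishing_pair_cup/vR => //; constructor 1.
  - by apply/vanishing_pair_cup/vR => //; constructor 2.
  rewrite inE => /orP[/eqP->|it] ci.
    case: ci => ci; first exact: vanishing_pair_cup_constant.
    exact: vanishing_pair_cup_swap.
  by apply/vanishing_pair_cup/vR => //; constructor 3; exists i.
case: goodQ => tQ sQ dQ vQ; have clQ : closed Q by case: tQ.
(* [mu] and its swap differ by [mu1] off the diagonal, where [Q] vanishes; so if
   every cell has a constant label, [P] is symmetric and its evaluation is a sum
   of equal pairs. *)
pose mu v : F := if side x y v then mu1 v + sgn F (row v y) else sgn F (row v x).
(* Where [side] holds, the set is {x, y} + {y} = {x} modulo two; as [side] is invariant under flips,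
   the two cases form one label. *)
have lab_mu : label [set x] mu.
  move=> l v vv; rewrite /mu side_flip; case: ifP => _; last exact: label_sgn.
  rewrite lab1 // (label_sgn odd_c pcharF) // !inE.
  rewrite addrACA; congr (_ + _).
  case: (eqVneq l x) => [->|lx] /=; last by rewrite F2D.
  by rewrite (negPf neq_xy) addr0.
have tP := tame_cup odd_c pcharF lab_mu tQ.
apply: contra_notP (elimN eqP coef_neq0) => nosep.
rewrite -(tame_evaluation odd_c d_gt0 pcharF tP) /evaluation.
set P := cobd _.
have vanP v : valid v -> diagonal_cell v -> P v = 0.
  move=> vv dv; apply: (vanishing_cobd (w := v)); last exact: below_refl.
  exact/vanishing_mul/dQ.
apply: (sum_involution pcharF (@swapK c d k x y)) => [v|v fv]; last first.
  case: (boolP (valid v)) => vv.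
    by rewrite vanP ?mulr0 //; apply/orP; left; rewrite -{1}fv row_swap tpermL.
  move: vv; rewrite negb_forall => /existsP[l nv].
  by rewrite (bigD1 l) //= {1}/top_weight /top_row (negPf nv) !mul0r.
rewrite [X in X * _](reindex_inj (@perm_inj _ (tperm x y))) /=.
under eq_bigr do rewrite row_swap tpermK.
case: (boolP (valid v)) => vv; last first.
  move: vv; rewrite negb_forall => /existsP[l nv].
  by rewrite (bigD1 l) //= {1 3}/top_weight /top_row (negPf nv) !mul0r.
congr (_ * _).
have -> : P (swap v) = P v + cobd (fun u => mu1 u * Q u) v.
  rewrite /P cobd_swap -cobdD; apply: eq_cobd_valid => // u vu; rewrite sQ //.
  case: (boolP (diagonal_cell u)) => du.
    by rewrite (dQ u vu du u (@below_refl _ _ _ u)) !mulr0 addr0.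
  rewrite -mulrDl; congr (_ * _); rewrite /mu side_swap // sym1 // !row_swap tpermL tpermR.
  by case: side => /=; rewrite 1?[RHS]addrAC ?F2D ?add0r // addrC.
suff -> : cobd (fun u => mu1 u * Q u) v = 0 by rewrite addr0.
apply: contrapT => nz; apply: nosep; exists v.
have vQ0 : vanishing v Q -> False.
  move=> vQ0; apply: nz.
  exact: (vanishing_cobd (vanishing_mul mu1 vQ0) (@below_refl _ _ _ v)).
split=> // [c0|c1|i si ci|j tj].
- by apply/vQ0/vQ => //; constructor 1.
- by apply: nz; apply: (vanishing_cup odd_c vv clQ c1) => //; exact: below_refl.
- by apply/vQ0/vQ => //; constructor 2; exists i.
- by split=> cj; apply/vQ0/vQ => //; constructor 3; exists j => //; [left|right].
Qed.

End SwapTheorem.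

(** * A coefficient of the Dickson product *)

Section Dickson.
Variables (F : comNzRingType) (pcharF : 2 \in [pchar F]) (k : nat).
Implicit Types (p : mpoly k F) (m : multinom k) (l x : 'I_k) (al be A : {set 'I_k}).
Local Notation "''t_' l" := (mpolyX F (mnm1 l)) (at level 8, l at level 2).
Local Notation form := (linear_form F).

Lemma pchar_mpoly2 : 2 \in [pchar (mpoly k F)].
Proof. exact: (rmorph_pchar (@mpolyC k F) pcharF). Qed.

Lemma addpp p : p + p = 0.
Proof. exact: (addrr_pchar2 pchar_mpoly2). Qed.

Lemma frobeniusE p s : p ^+ (2 ^ s) =
  \sum_(m <- msupp p) (mcoeff m p) ^+ (2 ^ s) *: mpolyX F (mnm_muln m (2 ^ s)).
Proof.
have frobD : {morph (fun p : mpoly k F => p ^+ (2 ^ s)) : p q / p + q}.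
  move=> p1 p2; apply: exprDn_pchar.
  by rewrite pnatX; apply/orP; left; rewrite pnatE // pchar_mpoly2.
rewrite {1}[p]mpolyE (big_morph _ frobD (id1 := 0)); last by rewrite expr0n expn_eq0.
by apply: eq_bigr => m _; rewrite exprZn mpolyXn.
Qed.

Lemma mcoeff_frobenius p s m :
  mcoeff (mnm_muln m (2 ^ s)) (p ^+ (2 ^ s)) = mcoeff m p ^+ (2 ^ s).
Proof.
have injM : injective (fun m : multinom k => mnm_muln m (2 ^ s)).
  move=> m1 m2 /mnmP eqm; apply/mnmP=> i; have := eqm i.
  by rewrite !mulmnE => /eqP; rewrite eqn_pmul2r ?expn_gt0 // => /eqP.
rewrite frobeniusE raddf_sum /=.
under eq_bigr do rewrite mcoeffZ mcoeffX (inj_eq injM).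
case: (boolP (m \in msupp p)) => mp; last first.
  rewrite big_seq big1 => [|m' m'p].
    by move: mp; rewrite mcoeff_msupp negbK => /eqP->; rewrite expr0n expn_eq0.
  by case: eqP => [mm|]; [rewrite -mm m'p in mp | rewrite mulr0].
rewrite (bigD1_seq m) ?msupp_uniq //= eqxx mulr1 big1 ?addr0 // => m' /negPf->.
by rewrite mulr0.
Qed.

Lemma mcoeff_frobenius_neq0 p s m : mcoeff m (p ^+ (2 ^ s)) != 0 ->
  exists2 m', m = mnm_muln m' (2 ^ s) & mcoeff m' p != 0.
Proof.
rewrite frobeniusE raddf_sum /= => nz.
have /hasP[m' m'p] : has (fun m' => mnm_muln m' (2 ^ s) == m) (msupp p).
  apply: contraNT nz => /hasPn nm; rewrite big_seq big1 // => m' m'p.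
  by rewrite mcoeffZ mcoeffX (negPf (nm _ m'p)) mulr0.
by move/eqP <-; exists m'; rewrite // -mcoeff_msupp.
Qed.

Lemma mcoeff_form m al : mcoeff m (form al) = \sum_(l in al) (mnm1 l == m)%:R.
Proof. by rewrite raddf_sum /=; apply: eq_bigr => l _; rewrite mcoeffX. Qed.

Lemma mcoeff_formU l al : mcoeff (mnm1 l) (form al) = (l \in al)%:R.
Proof.
have eqU i j : (@mnm1 k i == mnm1 j) = (i == j).
  apply/eqP/eqP => [/mnmP/(_ i)|->//]; rewrite !mnm1E eqxx.
  by case: eqP => [->|].
rewrite mcoeff_form; under eq_bigr do rewrite eqU.
case: (boolP (l \in al)) => lal; last first.
  by rewrite big1 // => i ial; case: eqP => // il; rewrite -il ial in lal.
by rewrite (bigD1 l) //= eqxx big1 ?addr0 // => i /andP[_ /negPf->].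
Qed.

Definition least al x := (x \in al) && [forall l in al, (x <= l)%N].

(** In the monomial order of [mlead] a variable of smaller index is larger. *)
Lemma mlead_form al x : least al x -> mlead (form al) = mnm1 x.
Proof.
case/andP=> xal /forall_inP xmin.
have xsupp : mnm1 x \in msupp (form al) by rewrite mcoeff_msupp mcoeff_formU xal oner_neq0.
have form_neq0 : form al != 0 by apply: contraTneq xsupp => ->; rewrite msupp0.
have := mlead_supp form_neq0; have := msupp_le_mlead xsupp.
set m := mlead _ => le_m; rewrite mcoeff_msupp mcoeff_form => nz.
have [l lal lm] : exists2 l, l \in al & m = mnm1 l.
  have /exists_inP[l lal /eqP <-] : [exists l in al, mnm1 l == m]; last by exists l.
  apply: contraNT nz => /exists_inPn nl; rewrite big1 // => l lal.
  by rewrite (negPf (nl l lal)).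
rewrite lm in le_m *; have := xmin l lal; rewrite leq_eqVlt => /orP[/eqP/val_inj->//|lt_xl].
suff : (mnm1 l < mnm1 x)%O by rewrite ltNge le_m.
apply/ltmcP; rewrite ?mdeg1 //; exists x => [j jx|]; rewrite !mnm1E; last first.
  by rewrite eqxx -val_eqE /= gtn_eqF.
by rewrite -!val_eqE /= !gtn_eqF // (ltn_trans jx).
Qed.

(** The product of p + v over the F_2-span of the variables in [al]: as a polynomial in [p], the
    linearized polynomial of this space. *)
Definition product_of_forms p al : mpoly k F := \prod_(be in powerset al) (p + form be).
Definition dickson : mpoly k F := \prod_(al : {set 'I_k} | al != set0) form al.

Lemma form0 : form (set0 : {set 'I_k}) = 0.
Proof. by rewrite /linear_form big_set0. Qed.

Lemma formU1 x al : x \notin al -> form (x |: al) = 't_x + form al.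
Proof. by move=> xal; rewrite /linear_form big_setU1. Qed.

Lemma product_of_forms0 p : product_of_forms p set0 = p.
Proof. by rewrite /product_of_forms powerset0 big_set1 form0 addr0. Qed.

Lemma big_powersetU1 (G : {set 'I_k} -> mpoly k F) x A : x \notin A ->
  \prod_(be in powerset (x |: A)) G be =
  (\prod_(be in powerset A) G be) * \prod_(be in powerset A) G (x |: be).
Proof.
move=> xA; rewrite (bigID (fun be : {set 'I_k} => x \in be)) /= mulrC; congr (_ * _).
  apply: eq_bigl => be; rewrite !powersetE.
  apply/andP/idP => [[sub xbe]|sub].
    apply/subsetP=> l lbe; move/subsetP/(_ l lbe): sub.
    by rewrite !inE => /predU1P[ll|//]; rewrite -ll lbe in xbe.
  by split; [apply: subset_trans sub (subsetUr _ _) | apply: contra xA; apply/subsetP].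
rewrite (reindex_onto (fun be => x |: be) (fun be => be :\ x)) /=; last first.
  by move=> be /andP[_ xbe]; rewrite setD1K.
apply: eq_bigl => be; rewrite !powersetE setU11 andbT.
apply/andP/idP => [[sub /eqP <-]|sub].
  apply/subsetP=> l; rewrite !inE => /andP[lx /orP[e|lbe]]; first by rewrite e in lx.
  have : l \in x |: be by rewrite !inE lbe orbT.
  by move/(subsetP sub); rewrite !inE (negPf lx).
split; first exact: setUS.
rewrite setU1K //; exact: contra (subsetP sub x) xA.
Qed.

Lemma product_of_formsU1 p x A : x \notin A ->
  product_of_forms p (x |: A) = product_of_forms p A * product_of_forms (p + 't_x) A.
Proof.
move=> xA; rewrite /product_of_forms big_powersetU1 //; congr (_ * _).
apply: eq_bigr => be; rewrite powersetE => sub; rewrite formU1 ?addrA //.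
exact: contra (subsetP sub x) xA.
Qed.


Lemma set_induction (P : {set 'I_k} -> Prop) :
  P set0 -> (forall x A, x \notin A -> P A -> P (x |: A)) -> forall A, P A.
Proof.
move=> P0 PU A; move: {2}#|A| (erefl #|A|) => n; elim: n A => [|n IHn] A.
  by move/cards0_eq->.
move=> cA; have [x xA] : exists x, x \in A by apply/card_gt0P; rewrite cA.
rewrite -(setD1K xA); apply: PU; first by rewrite !inE eqxx.
by apply: IHn; move: cA; rewrite (cardsD1 x) xA => -[].
Qed.

(** With L the product for [A], the next one sends p to L(p) L(p + t_x) = L(p)^2 + L(p) L(t_x),
    which is additive again since squaring is. *)
Lemma product_of_formsD A p q :
  product_of_forms (p + q) A = product_of_forms p A + product_of_forms q A.
Proof.
elim/set_induction: A p q => [|x A xA IHA] p q; first by rewrite !product_of_forms0.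
rewrite !product_of_formsU1 // !IHA.
set a := product_of_forms p A; set b := product_of_forms q A; set c := product_of_forms _ A.
transitivity (a * (a + c) + b * (b + c) + (a * b + a * b)); first by ring.
by rewrite addpp addr0.
Qed.

Definition free_of x p := forall m, mcoeff m p != 0 -> m x = 0%N.
Definition linearized x p := forall m, mcoeff m p != 0 -> exists a, m x = (2 ^ a)%N.

Lemma mcoeffM_neq0 p q m : mcoeff m (p * q) != 0 ->
  exists m1 m2, [/\ m = mnm_add m1 m2, mcoeff m1 p != 0 & mcoeff m2 q != 0].
Proof.
rewrite -mcoeff_msupp => /msuppM_le/allpairsP[[m1 m2] /= [m1p m2q ->]].
by exists m1, m2; rewrite -!mcoeff_msupp.
Qed.

Lemma mcoeffD_neq0 p q m :
  mcoeff m (p + q) != 0 -> mcoeff m p != 0 \/ mcoeff m q != 0.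
Proof.
rewrite mcoeffD => nz; have [p0|] := eqVneq (mcoeff m p) 0; last by left.
by right; move: nz; rewrite p0 add0r.
Qed.

Lemma free_ofM x p q : free_of x p -> free_of x q -> free_of x (p * q).
Proof.
move=> fp fq m /mcoeffM_neq0[m1 [m2 [-> /fp e1 /fq e2]]].
by rewrite mnmDE e1 e2.
Qed.

Lemma free_of1 x : free_of x 1.
Proof. by move=> m; rewrite mcoeff1; case: (m =P _) => [->|]; rewrite ?mnm0E ?eqxx. Qed.

Lemma free_of_form x al : x \notin al -> free_of x (form al).
Proof.
move=> xal m; rewrite mcoeff_form => nz.
have /exists_inP[l lal /eqP <-] : [exists l in al, mnm1 l == m].
  apply: contraNT nz => /exists_inPn nl; rewrite big1 // => l lal.
  by rewrite (negPf (nl l lal)).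
by rewrite mnm1E; case: eqP => // lx; rewrite -lx lal in xal.
Qed.

Lemma linearizedM x p q : free_of x p -> linearized x q -> linearized x (p * q).
Proof.
move=> fp lq m /mcoeffM_neq0[m1 [m2 [-> /fp e1 /lq[a e2]]]].
by exists a; rewrite mnmDE e1 e2.
Qed.

Lemma linearizedD x p q : linearized x p -> linearized x q -> linearized x (p + q).
Proof. by move=> lp lq m /mcoeffD_neq0[/lp|/lq]. Qed.

Lemma linearized_sqr x p : linearized x p -> linearized x (p ^+ 2).
Proof.
move=> lp m nz; have [m' -> /lp[a ea]] := mcoeff_frobenius_neq0 (s := 1) nz.
by exists a.+1; rewrite mulmnE ea [RHS]expnSr.
Qed.

Lemma form1 x : form [set x] = 't_x.
Proof. by rewrite /linear_form big_set1. Qed.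

Lemma free_of_product x p A : x \notin A -> free_of x p ->
  free_of x (product_of_forms p A).
Proof.
move=> xA fp; rewrite /product_of_forms.
elim/big_ind: _ => [|p1 p2|be]; [exact: free_of1 | exact: free_ofM |].
rewrite powersetE => sub m /mcoeffD_neq0[/fp//|]; apply: free_of_form.
exact: contra (subsetP sub x) xA.
Qed.

Lemma linearized_product x A : x \notin A -> linearized x (product_of_forms 't_x A).
Proof.
elim/set_induction: A => [|y A yA IHA] => [_|].
  rewrite product_of_forms0 => m; rewrite mcoeffX; case: (mnm1 x =P m) => [<-|]; last by rewrite eqxx.
  by exists 0%N; rewrite mnm1E eqxx.
rewrite !inE negb_or => /andP[xy xA].
rewrite product_of_formsU1 // product_of_formsD mulrDr -expr2.
apply: linearizedD; first exact/linearized_sqr/IHA.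
rewrite mulrC; apply: linearizedM; last exact: IHA.
by apply: free_of_product => //; rewrite -form1; apply: free_of_form; rewrite inE.
Qed.

(** The forms containing [x] make up the product of all t_x + v with v free of [x], which is
    linearized in t_x; the remaining forms do not involve t_x. *)
Lemma linearized_dickson x : linearized x dickson.
Proof.
have dicksonE : dickson = \prod_(al | (al != set0) && (x \notin al)) form al *
    product_of_forms 't_x [set~ x].
  rewrite /dickson (bigID (fun al : {set 'I_k} => x \notin al)) /=; congr (_ * _).
  rewrite /product_of_forms (reindex_onto (fun be => x |: be) (fun be => be :\ x)) /=.
    apply: eq_big => [be|be].
      rewrite powersetE setU11 /= andbT.
      have -> : x |: be != set0 by apply/set0Pn; exists x; rewrite setU11.
      apply/eqP/idP => [<-|sub]; first by apply/subsetP=> l; rewrite !inE => /andP[].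
      by rewrite setU1K //; apply/negP=> /(subsetP sub); rewrite !inE eqxx.
    case/andP=> _ /eqP def_be; rewrite formU1 // -def_be.
    by rewrite !inE eqxx.
  by move=> be /andP[_]; rewrite negbK => /setD1K.
rewrite dicksonE; apply: linearizedM; last first.
  by apply: linearized_product; rewrite !inE eqxx.
elim/big_ind: _ => [|p1 p2|be /andP[_]]; [exact: free_of1 | exact: free_ofM |].
exact: free_of_form.
Qed.

End Dickson.

Definition dickson_monomial n : multinom n.+1 :=
  Multinom [tuple (2 ^ (n - l))%N | l < n.+1].

(** Such a set is [l] together with any subset of the n - l larger indices. *)
Lemma card_least n (l : 'I_n.+1) :
  #|[set al : {set 'I_n.+1} | least al l]| = (2 ^ (n - l))%N.
Proof.
pose U := [set i : 'I_n.+1 | (l < i)%N].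
have cU : #|U| = (n - l)%N.
  have -> : #|U| = #|~: [set i : 'I_n.+1 | (i < l.+1)%N]|.
    by apply: eq_card => i; rewrite !inE ltnS -ltnNge.
  rewrite cardsCs setCK card_ord.
  have -> : #|[set i : 'I_n.+1 | (i < l.+1)%N]| = l.+1.
    rewrite -sum1_card -[RHS]card_ord -sum1_card.
    rewrite (big_ord_widen n.+1 (fun=> 1%N)) //.
    by apply: eq_bigl => i; rewrite inE.
  by rewrite subSS.
rewrite -cU -card_powerset.
have <- : (fun be => l |: be) @: powerset U = [set al | least al l].
  apply/setP=> al; rewrite inE; apply/imsetP/andP => [[be]|[lal /forall_inP lmin]].
    rewrite powersetE => sub ->; rewrite setU11; split=> //.
    apply/forall_inP=> i; rewrite !inE => /predU1P[->//|/(subsetP sub)].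
    by rewrite inE => /ltnW.
  exists (al :\ l); last by rewrite setD1K.
  rewrite powersetE; apply/subsetP=> i; rewrite !inE => /andP[il ial].
  by rewrite ltn_neqAle lmin // andbT eq_sym.
rewrite card_in_imset // => be be'; rewrite !powersetE => sub sub' eqU.
have nl (be0 : {set 'I_n.+1}) : be0 \subset U -> l \notin be0.
  by move=> s0; apply/negP=> /(subsetP s0); rewrite inE ltnn.
by rewrite -(setU1K (nl _ sub)) eqU setU1K // nl.
Qed.

(** [dickson_monomial] is the leading monomial: every form leads with its least variable, and
    [card_least] counts how often each variable is least. *)
Lemma mcoeff_dickson (F : comNzRingType) n :
  mcoeff (dickson_monomial n) (dickson F n.+1) = 1.
Proof.
pose lst (al : {set 'I_n.+1}) := odflt ord0 [pick l | least al l].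
have lstP al : al != set0 -> least al (lst al).
  case/set0Pn=> x xal; rewrite /lst; case: pickP => //= no.
  case: (arg_minnP (fun l : 'I_n.+1 => l : nat) xal) => l lal lmin.
  by have /negP[] := no l; apply/andP; split=> //; apply/forall_inP.
have leastE al l : al != set0 -> least al l = (lst al == l).
  move=> al0; apply/idP/eqP => [|<-]; last exact: lstP.
  have /andP[m_al /forall_inP m_min] := lstP al al0; case/andP=> lal /forall_inP lmin.
  by apply: ord_inj; apply/eqP; rewrite eqn_leq m_min // lmin.
have <- : (\big[@mnm_add n.+1/@mnm0 n.+1]_(al : {set 'I_n.+1} | al != set0) mlead (linear_form F al))
    = dickson_monomial n.
  apply/mnmP=> l; rewrite mnm_sumE mnmE -card_least -sum1_card.
  rewrite [RHS](eq_bigl (fun al : {set 'I_n.+1} => (al != set0) && (lst al == l))).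
    rewrite big_mkcondr; apply: eq_bigr => al al0.
    by rewrite (mlead_form F (lstP al al0)) mnm1E; case: eqP.
  move=> al; rewrite inE; case: (eqVneq al set0) => [->|al0] /=.
    by rewrite /least inE.
  exact: leastE.
rewrite mleadc_prod big1 // => al al0.
by rewrite (mlead_form F (lstP al al0)) mcoeff_formU; case/andP: (lstP al al0) => ->.
Qed.

(** * The coefficient needed by the swap argument *)

Section Coefficient.
Variables (F : comNzRingType) (pcharF : 2 \in [pchar F]) (n s : nat).
Let F2D := addrr_pchar2 pcharF.
Local Notation k := n.+2.
Local Notation "''t_' l" := (mpolyX F (mnm1 l)) (at level 8, l at level 2).
Local Notation form := (@linear_form k F).
Local Notation x := (@ord0 n.+1).
Local Notation y := (@ord_max n.+1).
Local Notation q := (2 ^ s.+1)%N.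

(* The dimension for [q = 2^(s+1)] masses and [n + 2] hyperplanes. *)
Definition dim := (2 ^ s * (2 ^ n.+1 + 1))%N.
Definition exponent (l : 'I_k) := (q * 2 ^ (n.+1 - l))%N.
Definition exponents (a b : nat) : multinom k :=
  Multinom [tuple if l == x then a else if l == y then b else exponent l | l < k].

Lemma exponentsE a b l :
  exponents a b l = if l == x then a else if l == y then b else exponent l.
Proof. exact: mnmE. Qed.

Lemma form_pair : form [set x; y] = 't_x + 't_y.
Proof. by rewrite /linear_form big_setU1 ?inE // big_set1. Qed.

Lemma exponents_subx a b : mnm_sub (exponents a b) (mnm1 x) = exponents a.-1 b.
Proof.
apply/mnmP=> l; rewrite mnmBE !exponentsE mnm1E.
by case: (eqVneq l x) => _; rewrite ?subn1 ?subn0.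
Qed.

Lemma exponents_suby a b : mnm_sub (exponents a b) (mnm1 y) = exponents a b.-1.
Proof.
apply/mnmP=> l; rewrite mnmBE !exponentsE mnm1E.
case: (eqVneq l x) => [->|_]; first by rewrite subn0.
by case: (eqVneq l y) => _; rewrite ?subn1 ?subn0.
Qed.

Lemma mcoeff_pair a b (P : mpoly k F) :
  mcoeff (exponents a b) (form [set x; y] * P) =
  (if (0 < a)%N then mcoeff (exponents a.-1 b) P else 0) +
  (if (0 < b)%N then mcoeff (exponents a b.-1) P else 0).
Proof.
rewrite form_pair mulrDl mcoeffD ![_ * P]mulrC !mcoeff_mulX.
by rewrite exponents_subx exponents_suby !exponentsE eqxx /= eqxx.
Qed.

(** By Frobenius and [linearized_dickson] the exponent of t_x is q times a power of two, and q 2^n <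
    dim together with 2 dim < q 2^(n+2) leaves only one in the range. *)
Lemma mcoeff_dickson_exponents a : (dim <= a <= dim.*2)%N ->
  mcoeff (exponents a (dim.*2 - a)) (dickson F k ^+ q) =
  (a == q * 2 ^ n.+1)%N%:R.
Proof.
move=> /andP[dim_a a_dim]; have eq_dim : dim.*2 = (q * (2 ^ n.+1 + 1))%N.
  by rewrite -muln2 /dim (expnSr 2 s) mulnAC.
case: eqP => [->|na].
  have -> : exponents (q * 2 ^ n.+1) (dim.*2 - q * 2 ^ n.+1) = mnm_muln (dickson_monomial n.+1) q.
    apply/mnmP=> l; rewrite mulmnE exponentsE mnmE eq_dim mulnDr muln1 addKn.
    case: (l =P x) => [->|_]; first by rewrite subn0 mulnC.
    case: (l =P y) => [->|_]; first by rewrite subnn mul1n.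
    by rewrite mulnC.
  by rewrite (mcoeff_frobenius pcharF) mcoeff_dickson expr1n.
apply/eqP; apply: contra_notT na => /(mcoeff_frobenius_neq0 pcharF)[m' /mnmP/(_ x)].
rewrite exponentsE mulmnE eqxx => def_a /(linearized_dickson pcharF x)[i def_i].
rewrite {}def_a def_i mulnC in dim_a a_dim *; congr (_ * 2 ^ _)%N.
have lt_n : (n.+1 < i.+1)%N.
  have : (2 ^ n.+1 + 1 <= 2 * 2 ^ i)%N.
    by move: dim_a; rewrite /dim (expnSr 2 s) -mulnA leq_pmul2l ?expn_gt0.
  by rewrite -expnS addn1 ltn_exp2l.
apply/eqP; rewrite eqn_leq -(ltnS n.+1) lt_n andbT leqNgt.
apply/negP; rewrite -(leq_exp2l _ _ (isT : 1 < 2)%N) => le_i.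
move: a_dim; rewrite eq_dim leq_pmul2l ?expn_gt0 // => /(leq_trans le_i).
by rewrite expnS mul2n -addnn leq_add2l leqNgt -{1}(expn0 2) ltn_exp2l.
Qed.

(** Coefficients of the quotient by t_x + t_y are partial sums of those of the dividend. Halfway, at
    exponent [dim], the sum has met the monomial with the large exponent at [x] but not its mirror
    image. *)
Lemma mcoeff_quotient (P : mpoly k F) :
  form [set x; y] * P = dickson F k ^+ q ->
  mcoeff (exponents dim.-1 dim) P = 1.
Proof.
move=> eqP.
have dim_gt0 : (0 < dim)%N by rewrite muln_gt0 expn_gt0 addn1.
(* Multiplying by [t_x + t_y] turns coefficients of [P] into telescoping sums. *)
pose g a := mcoeff (exponents a (dim.*2 - a)) (dickson F k ^+ q).
have sum_g i : (i <= dim)%N ->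
    mcoeff (exponents (dim.*2 - i).-1 i) P = \sum_(dim.*2 - i <= a < dim.*2.+1) g a.
  elim: i => [|i IHi] le_i.
    by rewrite subn0 big_nat1 /g -eqP subnn mcoeff_pair double_gt0 dim_gt0 addr0.
  have lt_i : (dim.*2 - i.+1 < dim.*2.+1)%N by rewrite ltnS leq_subr.
  rewrite big_ltn // -subSn; last by rewrite -addnn; apply: leq_trans (leq_addr _ _).
  rewrite subSS -IHi ?(ltnW le_i) // /g -eqP mcoeff_pair.
  have -> : (dim.*2 - (dim.*2 - i.+1) = i.+1)%N.
    by rewrite subKn // -addnn; apply: leq_trans (leq_addr _ _).
  have -> : (0 < dim.*2 - i.+1)%N by rewrite -addnn; lia.
  rewrite /= -addrA; have -> : (dim.*2 - i).-1 = (dim.*2 - i.+1)%N by lia.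
  by rewrite F2D addr0.
have := sum_g dim (leqnn _); rewrite -addnn addnK => ->.
rewrite (eq_big_nat _ _ (F2 := fun a => (a == q * 2 ^ n.+1)%N%:R)); last first.
  by move=> a; rewrite ltnS addnn; apply: mcoeff_dickson_exponents.
have in_range : (dim <= q * 2 ^ n.+1 < (dim + dim).+1)%N.
  have := expn_gt0 2 n.+1; have := expn_gt0 2 s; rewrite /dim (expnSr 2 s); nia.
rewrite -[LHS]/(\sum_(dim <= a < (dim + dim).+1) _).
rewrite (bigD1_seq (q * 2 ^ n.+1)%N) ?mem_index_iota ?iota_uniq //= eqxx.
by rewrite big1 ?addr0 // => a /negPf->.
Qed.

Variable j : nat.
Hypotheses (j_gt1 : (1 < j)%N) (j_le : (j <= q)%N).

(* Labels are pairs (A, i); indices [i >= j] are fictitious masses, whose label is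
   the model one.  The two labels of [reserved] are the ones consumed by the
   swap argument. *)
Definition present (p : {set 'I_k} * 'I_q) :=
  (p.1 != set0) && ~~ ((#|p.1| == 1%N) && (j <= p.2)%N).
Definition swap_stable (al : {set 'I_k}) := (x \in al) == (y \in al).
Definition reserved (p : {set 'I_k} * 'I_q) :=
  (p.1 == [set x; y]) && (p.2 < 2)%N.
(** The second list multiplies by powers of t_l, to raise the degree of the rows other than [x] and
    [y] to theirs; its indices start at [q], beyond all masses. *)
Definition stable_labels : seq ({set 'I_k} * nat) :=
  [seq (p.1, val p.2) | p : {set 'I_k} * 'I_q in
     [pred p | [&& present p, swap_stable p.1 & ~~ reserved p]]] ++
  [seq ([set l], (q + r)%N) | l <- enum [pred l : 'I_k | (l != x) && (l != y)],
     r <- iota 0 (dim - exponent l)].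
Definition pair_labels : seq ({set 'I_k} * nat) :=
  [seq (p.1, val p.2) | p : {set 'I_k} * 'I_q in
     [pred p | [&& present p, x \in p.1 & y \notin p.1]]].

Lemma neq_xy : x != y.
Proof. by []. Qed.

Lemma swap_setK : involutive (swap_set x y).
Proof. by move=> al; apply/setP=> l; rewrite !inE tpermK. Qed.

Lemma mem_swap_x al : (x \in swap_set x y al) = (y \in al).
Proof. by rewrite inE tpermL. Qed.

Lemma mem_swap_y al : (y \in swap_set x y al) = (x \in al).
Proof. by rewrite inE tpermR. Qed.

Lemma card_swap_set al : #|swap_set x y al| = #|al|.
Proof.
rewrite -(card_imset al (@perm_inj _ (tperm x y))); apply: eq_card => l.
rewrite inE; apply/idP/imsetP => [lal|[l' l'al ->]]; last by rewrite tpermK.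
by exists (tperm x y l); rewrite ?tpermK.
Qed.

Lemma present_swap p : present (swap_set x y p.1, p.2) = present p.
Proof. by rewrite /present /= -!cards_eq0 card_swap_set. Qed.

(** Every nonempty set with [q] indices gives the q-th power. The singletons with index [j] or more
    are the factors to be dropped; they amount to the same power of each variable. *)
Lemma dickson_factorization :
  form [set x; y] * (form [set x; y] *
    (\prod_(p | [&& present p, swap_stable p.1 & ~~ reserved p]) form p.1) *
    (\prod_(p | [&& present p, x \in p.1 & y \notin p.1])
       (form p.1 * form (swap_set x y p.1))) *
    \prod_l 't_l ^+ (q - j)) = dickson F k ^+ q.
Proof.
pose B := ({set 'I_k} * 'I_q)%type.
pose W : mpoly k F := \prod_(p : B | present p) form p.1.
have phantomE : \prod_(p : B | (p.1 != set0) && ((#|p.1| == 1%N) && (j <= p.2)%N)) form p.1 =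
    \prod_l 't_l ^+ (q - j).
  transitivity (\prod_(al : {set 'I_k} | #|al| == 1%N) \prod_(i < q | (j <= i)%N) form al).
    rewrite pair_big_dep /=; apply: eq_bigl => p; rewrite andbA; congr (_ && _).
    by rewrite andb_idl // => /eqP c1; rewrite -cards_eq0 c1.
  have cst (z : mpoly k F) : \prod_(i < q | (j <= i)%N) z = z ^+ (q - j).
    by rewrite -prodr_const_nat big_geq_mkord.
  rewrite (eq_bigr (fun al => form al ^+ (q - j))); last by move=> al _; exact: cst.
  rewrite (reindex_onto (fun l : 'I_k => [set l]) (fun al => odflt x [pick l in al])) /=.
    apply: eq_big => [l|l _]; last by rewrite form1.
    rewrite cards1 eqxx /=; case: pickP => [l'|/(_ l)]; rewrite ?inE ?eqxx //.
  move=> al /cards1P[l ->]; case: pickP => [l'|/(_ l)]; rewrite ?inE ?eqxx //.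
  by move/eqP->.
have dicksonE : dickson F k ^+ q = W * \prod_l 't_l ^+ (q - j).
  transitivity (\prod_(p : B | p.1 != set0) form p.1).
    transitivity (\prod_(al : {set 'I_k} | al != set0) \prod_(i < q) form al).
      by rewrite /dickson -prodrXl; apply: eq_bigr => al _; rewrite prodr_const card_ord.
    by rewrite pair_big_dep /=; apply: eq_bigl => p; rewrite andbT.
  by rewrite (bigID (fun p : B => (#|p.1| == 1%N) && (j <= p.2)%N)) /= phantomE mulrC.
have q_gt1 : (1 < q)%N by apply: leq_trans j_gt1 _.
pose p0 : B := ([set x; y], Ordinal (ltnW q_gt1)).
pose p1 : B := ([set x; y], Ordinal q_gt1).
have reservedE p : reserved p = (p == p0) || (p == p1).
  case: p => al [i lt_i]; rewrite /reserved !xpair_eqE -andb_orr.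
  by congr (_ && _); case: i lt_i => [|[|]].
have present_xy (i : 'I_q) : present ([set x; y], i).
  rewrite /present /= cards2 neq_xy /= andbT.
  by apply/set0Pn; exists x; rewrite !inE eqxx.
have stable_xy : swap_stable [set x; y] by rewrite /swap_stable !inE eqxx /= eqxx.
have WE : W = form [set x; y] * (form [set x; y] *
    (\prod_(p | [&& present p, swap_stable p.1 & ~~ reserved p]) form p.1)) *
    (\prod_(p | [&& present p, x \in p.1 & y \notin p.1])
       (form p.1 * form (swap_set x y p.1))).
  rewrite /W (bigID (fun p : B => swap_stable p.1)) /=; congr (_ * _).
    rewrite (bigD1 p0) /=; last by rewrite present_xy stable_xy.
    rewrite (bigD1 p1) /=; last first.
      by rewrite present_xy stable_xy /=; apply/eqP => -[].
    congr (_ * (_ * _)); apply: eq_bigl => p; rewrite reservedE negb_or.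
    by rewrite -!andbA.
  rewrite (bigID (fun p : B => x \in p.1)) /= big_split /=; congr (_ * _).
    apply: eq_bigl => p; rewrite /swap_stable -!andbA; congr (_ && _).
    by case: (x \in _); case: (y \in _).
  rewrite (reindex_inj (inv_inj (_ : involutive (fun p : B => (swap_set x y p.1, p.2))))) /=.
    apply: eq_bigl => p; rewrite present_swap /swap_stable mem_swap_x mem_swap_y -!andbA.
    by congr (_ && _); case: (x \in _); case: (y \in _).
  by case=> al i /=; rewrite swap_setK.
by rewrite dicksonE WE !mulrA.
Qed.

(** The dropped factors lower every exponent by q - j alike, so the coefficient is that of the
    quotient in [mcoeff_quotient]; [form [set x]], in place of the divisor, evens out its exponents
    dim - 1 and dim. *)
Lemma mcoeff_labels :
  mcoeff (top_degrees (dim - (q - j)) k)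
    (form [set x; y] * \prod_(p <- stable_labels) form p.1 *
     \prod_(p <- pair_labels) (form p.1 * form (swap_set x y p.1)) *
     form [set x]) = 1.
Proof.
set A1 := \prod_(p <- stable_labels) _; set A2 := \prod_(p <- pair_labels) _.
pose M : multinom k := Multinom [tuple if (l != x) && (l != y) then dim - exponent l else 0 | l < k]%N.
pose E : multinom k := Multinom [tuple q - j | l < k]%N.
have XE (m : multinom k) : mpolyX F m = \prod_l 't_l ^+ m l by rewrite -mpolyXE_id.
have A1E : A1 = \prod_(p | [&& present p, swap_stable p.1 & ~~ reserved p]) form p.1 * mpolyX F M.
  rewrite /A1 big_cat big_image /=; congr (_ * _).
  rewrite big_allpairs_dep /= big_enum_cond /= XE [RHS](bigID (fun l => (l != x) && (l != y))) /=.
  rewrite [X in _ = _ * X]big1 ?mulr1; last first.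
    by move=> l /negPf nl; rewrite mnmE nl expr0.
  apply: eq_big => [l|l nl]; first by rewrite andbT.
  have -> : M l = (dim - exponent l)%N by rewrite mnmE; move: nl; rewrite andbT inE => ->.
  under eq_bigr do rewrite form1.
  by rewrite big_const_seq count_predT size_iota iter_mulr_1.
have A2E : A2 = \prod_(p | [&& present p, x \in p.1 & y \notin p.1])
       (form p.1 * form (swap_set x y p.1)) by rewrite /A2 big_image.
have EE : mpolyX F E = \prod_l 't_l ^+ (q - j).
  by rewrite XE; apply: eq_bigr => l _; rewrite mnmE.
have q_dim : (q <= dim)%N.
  by rewrite /dim (expnSr 2 s) leq_pmul2l ?expn_gt0 // addn1 ltnW // ltnS -{1}(expn1 2) leq_exp2l.
have exponent_dim l : l != x -> (exponent l <= dim)%N.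
  move=> lx; rewrite /exponent /dim (expnSr 2 s) -mulnA leq_pmul2l ?expn_gt0 // -expnS.
  have l_gt0 : (0 < l)%N by rewrite lt0n.
  by apply: leq_trans (leq_addr 1 _); rewrite leq_exp2l //; lia.
have := mcoeff_quotient dickson_factorization; rewrite -EE -A2E.
set A0 := \prod_(p | _) form p.1 in A1E * => coef.
rewrite -(mcoeffMX _ E).
have -> : form [set x; y] * A1 * A2 * form [set x] * mpolyX F E =
   form [set x; y] * A0 * A2 * mpolyX F E * mpolyX F (mnm_add M (mnm1 x)).
  by rewrite A1E form1 mpolyXD; ring.
have -> : mnm_add E (top_degrees (dim - (q - j)) k) =
    mnm_add (mnm_add M (mnm1 x)) (exponents dim.-1 dim).
  apply/mnmP=> l; rewrite !mnmDE exponentsE mnm1E !mnmE.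
  have dim_gt0 : (0 < dim)%N by rewrite muln_gt0 expn_gt0 addn1.
  case: (eqVneq l x) => [->|lx] /=; first by lia.
  case: (eqVneq l y) => [_|ly] /=; first by lia.
  by have := exponent_dim l lx; lia.
by rewrite mcoeffMX coef.
Qed.

End Coefficient.

From mathcomp Require Import all_classical all_reals all_analysis.
Import numFieldNormedType.Exports.

(** * From sign labels to common zeros *)

Section ClusterPoint.
Local Open Scope classical_set_scope.

(** Compactness of the cube in terms of near coverings: if no point were a cluster point, [S n]
    would eventually miss the whole cube. *)
Lemma cluster_point (R : realType) (C : finType) (S : nat -> (C -> R) -> Prop) :
  (forall n, exists x, (forall p, `|x p| <= 1) /\ S n x) ->
  exists x, forall e : R, 0 < e -> forall N, exists2 n, (N <= n)%N &
    exists2 x', S n x' & forall p, `|x' p - x p| < e.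
Proof.
move=> exS; apply: contrapT => noc.
pose fn (v : 'rV[R]_#|C|) (p : C) := v ord0 (enum_rank p).
pose Box := [set v : 'rV[R]_#|C| | forall i, `[-1, 1]%classic (v ord0 i)].
have cBox : compact Box.
  exact: (@rV_compact R _ (fun=> `[(-1 : R), 1]) (fun=> @segment_compact R _ _)).
have := (compact_near_coveringP Box).1 cBox nat \oo (fun n v => ~ S n (fn v)) _.
case=> [v _|N _ noS]; last first.
  have [x [x1 Sx]] := exS N.
  pose v : 'rV[R]_#|C| := \row_i x (enum_val i).
  have fnv : fn v = x by apply/funext=> p; rewrite /fn mxE enum_rankK.
  apply: (noS N (leqnn N) v); last by rewrite fnv.
  by move=> i /=; rewrite mxE in_itv /= -ler_norml.
move/forallNP/(_ (fn v)) : noc => /existsNP[e /not_implyP[e_gt0 /existsNP[N noN]]].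
near=> v' n.
move=> Sn; apply: noN; exists n; first by near: n; exact: nbhs_infty_ge.
exists (fn v') => // p.
have : ball v e v' by near: v'; apply: nbhsx_ballx.
by case=> _ /(_ ord0 (enum_rank p)); rewrite /ball /= distrC.
Unshelve. all: by end_near.
Qed.

End ClusterPoint.

Lemma pchar_F2 : 2 \in [pchar 'F_2].
Proof. exact: pchar_Fp. Qed.

Section TestMap.
Variables (R : realType) (d k : nat).
Local Notation config := ('I_k * 'I_d.+1 -> R).
Local Notation pcell c := (cell c ('I_k * 'I_d.+1)%type).
Implicit Types (x : config) (T : config -> R) (l : 'I_k).

Definition nonzero_rows x := forall l, exists i, x (l, i) != 0.
Definition negate l x : config := fun p => if p.1 == l then - x p else x p.
Definition continuous_at T x := forall e, 0 < e ->
  exists2 e', 0 < e' & forall x', (forall p, `|x' p - x p| < e') -> `|T x' - T x| < e.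
Definition odd_in (al : {set 'I_k}) T :=
  forall l x, nonzero_rows x -> T (negate l x) = (-1) ^+ (l \in al) * T x.

(** The centre of the cell, with the grid scaled to [-1, 1]. *)
Definition position c (v : pcell c) : config :=
  fun p => ((v p)%:R - c%:R) / c%:R.

(* At a zero of [T] the sign is replaced by an arbitrary equivariant value. *)
Definition sign_label T al c (v : pcell c) : 'F_2 :=
  if 0 < T (position v) then 0 else if T (position v) < 0 then 1
  else model 'F_2 al v.

Section Position.
Variables (c : nat) (odd_c : odd c).
Implicit Types (v w : pcell c).

Let c_gt0 : 0 < c%:R :> R.
Proof. by rewrite ltr0n odd_gt0. Qed.

Let natr_double : (c.*2)%:R = c%:R + c%:R :> R.
Proof. by rewrite -addnn natrD. Qed.

Lemma position_flip l v : position (flip l v) = negate l (position v).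
Proof.
apply/funext=> p; rewrite /position /negate ffunE; case: eqP => // _.
rewrite rev_coordE natrB; last by rewrite -ltnS.
by rewrite -mulNr natr_double; congr (_ / _); ring.
Qed.

Lemma position_le1 v p : `|position v p| <= 1.
Proof.
rewrite /position normrM normfV (gtr0_norm c_gt0) ler_pdivrMr // mul1r ler_norml.
have : (v p <= c.*2)%N by rewrite -ltnS.
rewrite -(ler_nat R) natr_double => le_v.
have := ler0n R (v p); lra.
Qed.

Lemma position_extreme v l : valid v -> exists i, `|position v (l, i)| = 1.
Proof.
move/forallP/(_ l)/existsP => [i]; rewrite ffunE extremeE => ext; exists i.
rewrite /position normrM normfV (gtr0_norm c_gt0).
have -> : `|(v (l, i))%:R - c%:R| = c%:R :> R.
  case/orP: ext => /eqP->; first by rewrite sub0r normrN ger0_norm ?ler0n.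
  by rewrite natr_double addrK ger0_norm ?ler0n.
by rewrite divff // gt_eqF.
Qed.

Lemma nonzero_rows_position v : valid v -> nonzero_rows (position v).
Proof.
move=> vv l; have [i pi] := position_extreme l vv; exists i.
by rewrite -normr_gt0 pi ltr01.
Qed.

Lemma position_below v w p : below v w -> `|position v p - position w p| <= c%:R^-1.
Proof.
move=> /(_ p) vw; rewrite /position -mulrBl opprB addrA subrK normrM normfV.
rewrite (gtr0_norm c_gt0); apply: ler_piMl; first by rewrite invr_ge0 ltW.
rewrite ler_norml.
case: vw => [->|[_ _]]; first by rewrite subrr lerN10 ler01.
by rewrite -!(ler_nat R) -!natr1; lra.
Qed.

Lemma label_sign_label T al : odd_in al T -> label al (sign_label T al (c := c)).
Proof.
move=> oddT l v vv; rewrite /sign_label position_flip oddT; last exact: nonzero_rows_position.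
have F2D := addrr_pchar2 pchar_F2.
have labm := label_model odd_c pchar_F2 al l vv.
rewrite labm; case: (l \in al); rewrite ?expr0 ?expr1 ?mul1r ?mulN1r ?addr0 //.
by rewrite oppr_gt0 oppr_lt0; case: ltrgtP; rewrite ?add0r ?F2D.
Qed.

Lemma constant_sign_label T al w :
  (forall v, below v w -> 0 < T (position v)) \/
  (forall v, below v w -> T (position v) < 0) ->
  constant_below w (sign_label T al (c := c)).
Proof.
case=> sgnT v vw; rewrite /sign_label; have Tv := sgnT v vw; have Tw := sgnT w (below_refl _).
  by rewrite Tv Tw.
by rewrite (lt_gtF Tv) (lt_gtF Tw) Tv Tw.
Qed.

End Position.

Lemma constant_near_nonzero T al x : continuous_at T x -> T x != 0 ->
  exists2 e : R, 0 < e & exists N, forall c (w : pcell c), (N <= c)%N -> odd c ->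
    (forall p, `|position w p - x p| < e) ->
    constant_below w (sign_label T al (c := c)).
Proof.
move=> contT Tx; have := Tx; rewrite -normr_gt0 => /contT[e e_gt0 near_x].
exists (e / 2); first by rewrite divr_gt0.
have [N ltN] : exists N : nat, 2 / e < N%:R.
  exists (Num.bound (2 / e)); rewrite archi_boundP // divr_ge0 // ltW //.
exists N.+1 => c w Nc odd_c near_w.
have c_gt0 : 0 < c%:R :> R by rewrite ltr0n (leq_trans _ Nc).
have close v : below v w -> `|T (position v) - T x| < `|T x|.
  move=> vw; apply: near_x => p.
  have := position_below odd_c p vw; have := near_w p.
  have : c%:R^-1 < e / 2.
    rewrite -[e / 2]invrK ltf_pV2 ?posrE ?invr_gt0 ?divr_gt0 // invf_div.
    by apply: lt_le_trans ltN _; rewrite ler_nat ltnW.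
  have := ler_normD (position v p - position w p) (position w p - x p).
  by rewrite addrA subrK; lra.
apply: constant_sign_label; case/orP: (lt_total Tx) => sTx; [right|left] => v /close.
  by rewrite (ltr0_norm sTx) ltr_distl; lra.
by rewrite (gtr0_norm sTx) ltr_distl; lra.
Qed.

(** Cells without constant labels, on ever finer grids, accumulate at a point where all wanted
    functions vanish. [D] marks cells where the separation may fail because of [T i0]; they stay
    away from the limit, near which [T i0] either has constant sign or is smaller than [kappa] in
    absolute value. *)
Lemma zero_of_labels (I : Type) (T : I -> config -> R) (al : I -> {set 'I_k})
    (A : I -> Prop) (i0 : I) (kappa : R) (D : forall c, pcell c -> Prop) :
  0 < kappa ->
  (forall i x, nonzero_rows x -> continuous_at (T i) x) ->
  (forall c (w : pcell c), odd c -> valid w -> D c w -> kappa <= `|T i0 (position w)|) ->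
  (forall c, odd c -> exists2 w : pcell c, valid w &
    (forall i, A i -> ~ constant_below w (sign_label (T i) (al i) (c := c))) \/
    D c w /\ ~ constant_below w (sign_label (T i0) (al i0) (c := c))) ->
  exists2 x, nonzero_rows x & forall i, A i -> T i x = 0.
Proof.
move=> kappa_gt0 contT TD bad.
pose B c (w : pcell c) := (forall i, A i -> ~ constant_below w (sign_label (T i) (al i) (c := c))) \/
    D c w /\ ~ constant_below w (sign_label (T i0) (al i0) (c := c)).
pose S n x := exists w : pcell n.*2.+1, [/\ valid w, position w = x & B _ w].
have odd_n n : odd n.*2.+1 by rewrite /= odd_double.
have [n|x clx] := @cluster_point R _ S.
  have [w vw Bw] := bad _ (odd_n n); exists (position w); split; last by exists w.
  by move=> p; apply: position_le1.
have nzx : nonzero_rows x.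
  move=> l; have [n _ [_ [w [vw <- _]] near_w]] := clx 1 ltr01 0%N.
  have [i ei] := position_extreme (odd_n n) l vw; exists i.
  apply: contraTneq (near_w (l, i)) => ->; rewrite subr0 ei ltxx //.
have [e e_gt0 [N starN]] : exists2 e : R, 0 < e & exists N, forall c (w : pcell c),
    (N <= c)%N -> odd c -> valid w -> (forall p, `|position w p - x p| < e) ->
    ~ (D c w /\ ~ constant_below w (sign_label (T i0) (al i0) (c := c))).
  have [T0|T0] := eqVneq (T i0 x) 0; last first.
    have [e e_gt0 [N cN]] := constant_near_nonzero (al i0) (contT i0 x nzx) T0.
    by exists e => //; exists N => c w Nc oc vw nw [_]; apply; apply: cN.
  have [e e_gt0 near_x] := contT i0 x nzx kappa kappa_gt0.
  exists e => //; exists 0%N => c w _ oc vw nw [Dw _].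
  have := near_x _ nw; rewrite T0 subr0 => lt_k.
  by have := TD c w oc vw Dw; rewrite leNgt lt_k.
exists x => // i Ai; apply/eqP/negPn/negP => Tx.
have [e' e'_gt0 [N' cN]] := constant_near_nonzero (al i) (contT i x nzx) Tx.
have min_gt0 : 0 < Num.min e e' by rewrite lt_min e_gt0.
have [n le_n [_ [w [vw <- Bw]] near_w]] := clx _ min_gt0 (maxn N N').
have le_c : (maxn N N' <= n.*2.+1)%N by rewrite (leq_trans le_n) // ltnW // ltnS -addnn leq_addr.
move: le_c; rewrite geq_max => /andP[Nc N'c].
case: Bw => [|star]; last first.
  apply: (starN _ w Nc (odd_n n) vw _ star) => p.
  by have := near_w p; rewrite lt_min => /andP[].
move/(_ i Ai); apply; apply: cN => // p.
by have := near_w p; rewrite lt_min => /andP[].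
Qed.

End TestMap.

(** The Borsuk-Ulam theorem: one row and no exceptional cells. *)
Theorem common_zero_sphere (R : realType) (d j : nat)
    (T : 'I_j -> ('I_1 * 'I_d.+1 -> R) -> R) :
  (0 < j <= d)%N ->
  (forall i, odd_in [set ord0] (T i)) ->
  (forall i x, nonzero_rows x -> continuous_at (T i) x) ->
  exists2 x, nonzero_rows x & forall i, T i x = 0.
Proof.
move=> /andP[j_gt0 le_jd] oddT contT.
pose i0 := Ordinal j_gt0.
have [|x nzx Tx] := @zero_of_labels R d 1 'I_j T (fun=> [set ord0]) (fun=> True) i0 1
  (fun _ _ => False) ltr01 contT (fun _ _ _ _ => False_ind _).
  move=> c odd_c.
  (* Model labels fill up the degree to [d]. *)
  pose s : seq ('I_j + unit) := [seq inl i | i <- enum 'I_j] ++ nseq (d - j) (inr tt).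
  pose lam (z : 'I_j + unit) : cell c ('I_1 * 'I_d.+1)%type -> 'F_2 :=
    match z with inl i => sign_label (T i) [set ord0] (c := c) | inr _ => model 'F_2 [set ord0] end.
  have d_gt0 : (0 < d)%N by apply: leq_trans le_jd.
  have [|| w vw sep] := @labels_separated c d 1 odd_c d_gt0 'F_2 pchar_F2 _ s lam
    (fun=> [set ord0]).
  - case=> [i|[]] _; first exact: (label_sign_label odd_c (oddT i)).
    exact: (label_model odd_c pchar_F2).
  - rewrite big_const_seq count_predT iter_mulr_1 size_cat size_map size_nseq.
    rewrite -cardE card_ord subnKC // form1 mpolyXn mcoeffX.
    suff -> : mnm_muln (mnm1 ord0) d = top_degrees d 1 by rewrite eqxx oner_neq0.
    by apply/mnmP=> l; rewrite mulmnE mnm1E mnmE [l]ord1 eqxx mul1n.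
  exists w => //; left=> i _; apply: (sep (inl i)).
  by rewrite mem_cat map_f // mem_enum.
by exists x => // i; apply: Tx.
Qed.

(** * Common zeros of swap-symmetric test maps *)

Section CommonZero.
Variables (R : realType) (n s j : nat).
Hypotheses (j_gt1 : (1 < j)%N) (j_le : (j <= 2 ^ s.+1)%N).
Local Notation k := n.+2.
Local Notation d := (dim n s - (2 ^ s.+1 - j))%N.
Local Notation config := ('I_k * 'I_d.+1 -> R).
Local Notation a := (@ord0 n.+1).
Local Notation b := (@ord_max n.+1).
Local Notation pair := [set a; b].

Variable T : {set 'I_k} -> 'I_j -> config -> R.
Variable kappa : R.
Hypothesis kappa_gt0 : 0 < kappa.
Hypothesis oddT : forall al i, odd_in al (T al i).
Hypothesis contT : forall al i x, nonzero_rows x -> continuous_at (T al i) x.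
Hypothesis swapT : forall al i x, nonzero_rows x ->
  T (swap_set a b al) i (fun p => x (tperm a b p.1, p.2)) = T al i x.
Hypothesis diagT : forall x, nonzero_rows x ->
  (forall l, x (a, l) = x (b, l)) \/ (forall l, x (a, l) = - x (b, l)) ->
  kappa <= `|T pair (Ordinal (ltnW j_gt1)) x|.

Let swap_set_stable al : swap_stable al -> swap_set a b al = al.
Proof.
move/eqP=> st; apply/setP=> l; rewrite inE.
by case: tpermP => [->|->|//]; rewrite st.
Qed.

Section Labels.
Variables (c : nat) (odd_c : odd c).
Local Notation pcell := (cell c ('I_k * 'I_d.+1)%type).
Local Notation lbl al i := (sign_label (T al i) al (c := c)).

Let sign_label_swap al i (v : pcell) : valid v ->
  sign_label (T (swap_set a b al) i) (swap_set a b al) (swap a b v) = lbl al i v.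
Proof.
move=> vv; rewrite /sign_label.
have -> : T (swap_set a b al) i (position R (swap a b v)) = T al i (position R v).
  rewrite -[RHS]swapT; last exact: nonzero_rows_position.
  by congr (T _ i _); apply/funext=> p; rewrite /position ffunE.
case: (0 < _) => //; case: (_ < 0) => //.
rewrite /model (reindex_inj (@perm_inj _ (tperm a b))) /=.
by apply: eq_big => [l|l _]; rewrite ?inE ?row_swap ?tpermK.
Qed.

Let lam (p : {set 'I_k} * nat) (v : pcell) : 'F_2 :=
  if insub p.2 is Some i then lbl p.1 i v else model 'F_2 p.1 v.

Let label_lam p : label p.1 (lam p).
Proof.
rewrite /lam; case: insub => [i|]; last exact: label_model pchar_F2 _.
exact: label_sign_label.
Qed.

Let lamE al (i : 'I_j) : lam (al, val i) = lbl al i.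
Proof. by rewrite /lam valK. Qed.

Let symmetric_lam p : swap_stable p.1 -> symmetric_cochain a b (lam p).
Proof.
move=> /swap_set_stable st v vv; rewrite /lam; case: insub => [i|].
  by rewrite -[RHS]sign_label_swap // st.
rewrite /model (reindex_inj (@perm_inj _ (tperm a b))) /=.
by apply: eq_big => [l|l _]; rewrite ?row_swap ?tpermK // -{1}st inE tpermK.
Qed.

(** Either the first reserved label is nonconstant on some diagonal cell, the exceptional case of
    [zero_of_labels], or [symmetric_labels_separated] applies. *)
Lemma sign_labels_separated : exists2 w : pcell, valid w &
  (forall p : {set 'I_k} * 'I_j, p.1 != finset.set0 -> ~ constant_below w (lbl p.1 p.2)) \/
  diagonal_cell a b w /\ ~ constant_below w (lbl pair (Ordinal (ltnW j_gt1))).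
Proof.
pose i0 := Ordinal (ltnW j_gt1); pose i1 := Ordinal j_gt1.
have [[w [vw dw nw]]|nobad] := pselect (exists w : pcell,
    [/\ valid w, diagonal_cell a b w & ~ constant_below w (lbl pair i0)]).
  by exists w => //; right.
have stp : swap_stable pair by rewrite /swap_stable !inE eqxx /= eqxx.
have d_gt0 : (0 < d)%N.
  have q_gt0 : (0 < 2 ^ s)%N by rewrite expn_gt0.
  have n_gt1 : (1 < 2 ^ n.+1)%N by rewrite -{1}(expn0 2) ltn_exp2l.
  rewrite subn_gt0 (leq_ltn_trans (leq_subr _ _)) // /dim (expnSr 2 s).
  by rewrite ltn_mul2l q_gt0 addn1 ltnS.
have coef := mcoeff_labels pchar_F2 n j_gt1 j_le.
have [||||||||w [vw n0 n1 nst npair]] := @symmetric_labels_separated c d k odd_c d_gt0 a b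
  (@neq_xy n) 'F_2 pchar_F2 _ _ (stable_labels n s j) (pair_labels n s j)
  (lbl pair i0) (lbl pair i1) lam (fun p => p.1) lam (fun p => p.1).
- exact: label_sign_label.
- by rewrite -lamE; apply: symmetric_lam.
- move=> v vv dv; apply: contrapT => nc; apply: nobad; by exists v.
- exact: label_sign_label.
- by rewrite -lamE; apply: symmetric_lam.
- move=> p pst; split; first exact: label_lam.
  apply: symmetric_lam; move: pst; rewrite mem_cat => /orP[/mapP[q + ->]|].
    by rewrite mem_enum inE => /and3P[].
  case/allpairsPdep=> l [r [+ _ ->]]; rewrite mem_enum inE => /andP[la lb].
  by rewrite /swap_stable !inE ![_ == l]eq_sym (negPf la) (negPf lb).
- by move=> p _; apply: label_lam.
- by rewrite coef oner_neq0.
exists w => //; left=> -[al i] /= al0.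
have present_i : present (n := n) (s := s) j (al, widen_ord j_le i).
  by rewrite /present al0 /= leqNgt ltn_ord andbF.
have [st|nst_al] := boolP (swap_stable al).
  have [/andP[/= /eqP-> i_lt2]|nres] := boolP (reserved (n := n) (s := s) (al, widen_ord j_le i)).
    case: i i_lt2 {present_i} => -[|[|//]] lt_i _ /=.
      by rewrite (bool_irrelevance lt_i (ltnW j_gt1)).
    by rewrite (bool_irrelevance lt_i j_gt1).
  have := nst (al, val i); rewrite lamE; apply.
  rewrite mem_cat; apply/orP; left; apply/mapP; exists (al, widen_ord j_le i) => //.
  by rewrite mem_enum inE present_i st.
have [a_al|a_al] := boolP (a \in al).
  have b_al : b \notin al by move: nst_al; rewrite /swap_stable a_al; case: (b \in al).
  have [|+ _] := npair (al, val i); last by rewrite lamE.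
  by apply/mapP; exists (al, widen_ord j_le i) => //; rewrite mem_enum inE present_i a_al.
have b_al : b \in al by move: nst_al; rewrite /swap_stable (negPf a_al); case: (b \in al).
(* The list holds only the partner that contains [a]; its swapped label is the label of [al]. *)
have [|_] := npair (swap_set a b al, val i).
  apply/mapP; exists (swap_set a b al, widen_ord j_le i) => //.
  rewrite mem_enum inE /= mem_swap_x mem_swap_y b_al a_al andbT.
  by rewrite (present_swap j (al, widen_ord j_le i)) present_i.
rewrite lamE; apply: contra_not => cw v vw'.
have swE u : valid u -> lbl (swap_set a b al) i (swap a b u) = lbl al i u.
  exact: sign_label_swap.
by rewrite (swE _ (valid_below odd_c vw' vw)) (swE _ vw); apply: cw.
Qed.

End Labels.

Theorem common_zero_product :
  exists2 x, nonzero_rows x & forall al i, al != finset.set0 -> T al i x = 0.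
Proof.
pose i0 : {set 'I_k} * 'I_j := (pair, Ordinal (ltnW j_gt1)).
have [| | |x nzx Tx] := @zero_of_labels R d k _ (fun p => T p.1 p.2) (fun p => p.1)
  (fun p => p.1 != finset.set0) i0 kappa (fun c w => diagonal_cell a b w) kappa_gt0.
- by move=> p x nzx; apply: contT.
- move=> c w odd_c vw dw; apply: diagT; first exact: nonzero_rows_position.
  have rowE l i : position R w (l, i) = ((row w l i)%:R - c%:R) / c%:R.
    by rewrite /position ffunE.
  case/orP: dw => /eqP eq_row; [left|right] => i; rewrite !rowE eq_row //.
  rewrite ffunE rev_coordE natrB; last by rewrite -ltnS.
  have -> : (c.*2)%:R = c%:R + c%:R :> R by rewrite -addnn natrD.
  by rewrite -mulNr; congr (_ / _); ring.
- by move=> c odd_c; have [w vw sep] := sign_labels_separated odd_c; exists w.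
by exists x => // al i al0; apply: (Tx (al, i)).
Qed.

End CommonZero.

Local Open Scope classical_set_scope.

(** * Orthant measures *)

Section Regions.
Variables (R : realType) (d k : nat).
Local Notation space := 'rV[R]_d.
Local Notation config := ('I_k * 'I_d.+1 -> R).
Local Notation signs := {ffun 'I_k -> bool}.
Implicit Types (x : config) (s : signs) (p : space) (mu : mass R d).

Definition height x l p : R :=
  \sum_(i < d) x (l, widen_ord (leqnSn d) i) * p ord0 i - x (l, ord_max).

Definition region x s : set space :=
  [set p | forall l, if s l then 0 < height x l p else height x l p < 0].

Definition walls x : set space := \bigcup_l [set p | height x l p = 0].

Lemma continuous_sumr (I : finType) (f : I -> space -> R) :
  (forall i, continuous (f i)) -> continuous (fun p => \sum_i f i p).
Proof.
move=> cf; apply: (@continuous_big R I +%R 0 xpredT).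
  by move=> y; apply: add_continuous.
by move=> i _; apply: cf.
Qed.

Lemma continuous_height x l : continuous (height x l).
Proof.
have cs : continuous (fun p : space =>
    \sum_(i < d) x (l, widen_ord (leqnSn d) i) * p ord0 i).
  apply: continuous_sumr => i q.
  apply: (@continuousM _ _ (fun=> x (l, widen_ord (leqnSn d) i)) (fun p : space => p ord0 i)).
    exact: cst_continuous.
  exact: coord_continuous.
move=> p; apply: (@continuousB _ _ _ _ (fun=> x (l, ord_max))); first exact: cs.
exact: cst_continuous.
Qed.

Lemma measurable_positive (f : space -> R) : continuous f ->
  measurable ([set p | 0 < f p] : set (borel_rV R d)).
Proof.
move=> cf; apply: sub_sigma_algebra.
apply: (@open_comp _ _ f [set y | 0 < y]); last exact: open_gt.
by move=> p _; apply: cf.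
Qed.

Lemma measurable_region x s : measurable (region x s : set (borel_rV R d)).
Proof.
have -> : region x s = \bigcap_(l in [set: 'I_k])
    [set p | 0 < (if s l then height x l p else - height x l p)].
  apply/seteqP; split=> p rp l => [_|]; have := rp l; last move/(_ I) => /=.
    by case: ifP => //= _; rewrite oppr_gt0.
  by case: ifP => //= _; rewrite oppr_gt0.
apply: fin_bigcap_measurable => [|l _]; first exact: finite_finset.
apply: measurable_positive => p; case: (s l); first exact: continuous_height.
by apply: continuousN; exact: continuous_height.
Qed.

Lemma measurable_wall x l : measurable ([set p | height x l p = 0] : set (borel_rV R d)).
Proof.
have -> : [set p | height x l p = 0] =
    ~` ([set p | 0 < height x l p] `|` [set p | 0 < - height x l p]).
  apply/seteqP; split=> p /=; first by move=> ->; rewrite oppr0 ltxx; case.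
  by rewrite oppr_gt0 => /not_orP[/negP + /negP]; case: ltrgtP.
apply: measurableC; apply: measurableU; apply: measurable_positive.
  exact: continuous_height.
by move=> p; apply: continuousN; exact: continuous_height.
Qed.

Lemma measurable_walls x : measurable (walls x : set (borel_rV R d)).
Proof.
apply: fin_bigcup_measurable => [|l _]; first exact: finite_finset.
exact: measurable_wall.
Qed.

Definition normal_row x l : space := \row_i x (l, widen_ord (leqnSn d) i).

Lemma heightE x l p : height x l p = dotv (normal_row x l) p - x (l, ord_max).
Proof. by congr (_ - _); apply: eq_bigr => i _; rewrite mxE. Qed.

(** A nonzero row with zero normal has no wall: its height is a nonzero constant. *)
Lemma mass_wall mu x l : nonzero_rows x -> mu [set p | height x l p = 0] = 0%E.
Proof.
move=> nzx; have [n0|n0] := eqVneq (normal_row x l) 0; last first.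
  rewrite -(mass_hyperplane mu (Hyperplane (x (l, ord_max)) n0)); congr (mu _).
  apply/seteqP; split=> p /=; rewrite heightE.
    by move/eqP; rewrite subr_eq0 => /eqP.
  by move=> ->; rewrite subrr.
have x0 i : x (l, widen_ord (leqnSn d) i) = 0.
  by have := congr1 (fun v : space => v ord0 i) n0; rewrite !mxE.
have max_neq0 : x (l, ord_max) != 0.
  have [i] := nzx l; have [lt_id|] := ltnP i d.
    by have <- : widen_ord (leqnSn d) (Ordinal lt_id) = i; [exact: val_inj|rewrite x0 eqxx].
  move=> le_di; suff -> : i = ord_max by [].
  by apply: val_inj; apply/eqP; rewrite eqn_leq le_di -ltnS ltn_ord.
have -> : [set p | height x l p = 0] = set0; last exact: measure0.
apply/seteqP; split=> p //=; rewrite heightE n0 /dotv big1 => [|i _]; last first.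
  by rewrite mxE mul0r.
by rewrite sub0r => /eqP; rewrite oppr_eq0 (negPf max_neq0).
Qed.

Lemma mass_walls mu x : nonzero_rows x -> mu (walls x) = 0%E.
Proof.
move=> nzx; rewrite /walls.
have -> : \bigcup_l [set p | height x l p = 0] =
    \big[setU/set0]_(l <- enum 'I_k) [set p | height x l p = 0].
  rewrite -bigcup_seq; apply/seteqP; split=> p [l _ hl]; exists l => //.
  by rewrite /= mem_enum.
pose Q (A : set (borel_rV R d)) := measurable A /\ mu A = 0%E.
suff [] : Q (\big[setU/set0]_(l <- enum 'I_k) [set p | height x l p = 0]) by [].
apply: big_ind => [|A B [mA A0] [mB B0]|l _].
- by split; [exact: measurable0|exact: measure0].
- by split; [exact: measurableU|exact: null_set_setU].
- by split; [exact: measurable_wall|exact: mass_wall].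
Qed.

Definition weight mu x s : R := fine (mu (region x s)).
Definition total mu : R := fine (mu [set: space]).

Lemma weightE mu x s : mu (region x s) = (weight mu x s)%:E.
Proof. by rewrite /weight fineK // fin_num_measure //; apply: measurable_region. Qed.

Lemma totalE mu : mu [set: space] = (total mu)%:E.
Proof. by rewrite /total fineK // fin_num_measure //; apply: measurableT. Qed.

Lemma region_inj x s t p : region x s p -> region x t p -> s = t.
Proof.
move=> xs xt; apply/ffunP=> l; have := xt l; have := xs l.
by case: (s l); case: (t l) => // h1 h2; have := lt_trans h1 h2; rewrite ltxx.
Qed.

Lemma sum_weight mu x : nonzero_rows x -> \sum_s weight mu x s = total mu.
Proof.
move=> nzx; apply/EFin_inj; rewrite -totalE -sumEFin.
have -> : [set: space] = (\bigcup_(s in [set` enum {: signs}]) region x s) `|` walls x.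
  apply/seteqP; split=> p // _.
  have [wp|nwp] := pselect (walls x p); [by right|left].
  exists [ffun l => 0 < height x l p] => [|l]; first by rewrite /= mem_enum.
  rewrite ffunE; case: ltrgtP => // h0; exfalso; apply: nwp; exists l => //.
have mU : measurable (\bigcup_(s in [set` enum {: signs}]) region x s : set (borel_rV R d)).
  by apply: fin_bigcup_measurable => [|s _]; [exact: finite_seq|exact: measurable_region].
rewrite (measureU0 mU (measurable_walls x)); last exact: mass_walls.
rewrite measure_fin_bigcup; [|exact: finite_seq|..].
- rewrite -fsbig_seq ?enum_uniq // big_enum /=.
  by apply: eq_bigr => s _; rewrite weightE.
- apply/trivIsetP => s t _ _ /eqP st; apply/seteqP; split=> p // [ps pt].
  by apply: st; apply: region_inj ps pt.
- by move=> s _; apply: measurable_region.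
Qed.

End Regions.

Section Continuity.
Variables (R : realType) (d k : nat).
Local Notation space := 'rV[R]_d.
Local Notation config := ('I_k * 'I_d.+1 -> R).
Implicit Types (x : config) (p : space) (mu : mass R d).

(* Changing all coefficients by less than [e] moves each height by at most
   [e * size1 p]. *)
Definition size1 p : R := 1 + \sum_i `|p ord0 i|.

Lemma size1_ge1 p : 1 <= size1 p.
Proof. by rewrite lerDl sumr_ge0. Qed.

Lemma continuous_size1 : continuous size1.
Proof.
have cs : continuous (fun p : space => \sum_i `|p ord0 i|).
  apply: continuous_sumr => i q.
  apply: (@continuous_comp _ _ _ (fun p : space => p ord0 i) (fun y : R => `|y|)).
    exact: coord_continuous.
  exact: norm_continuous.
move=> p; apply: (@continuousD R R^o space (fun=> 1) (fun p : space => \sum_i `|p ord0 i|) p).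
  exact: cst_continuous.
exact: cs.
Qed.

(** Contains every point whose signs can change when all coefficients move by less than 1/(n+1). *)
Definition near_walls x n : set space :=
  \bigcup_l [set p | n.+1%:R * `|height x l p| <= size1 p].

Lemma measurable_near_walls x n : measurable (near_walls x n : set (borel_rV R d)).
Proof.
apply: fin_bigcup_measurable => [|l _]; first exact: finite_finset.
have -> : [set p | n.+1%:R * `|height x l p| <= size1 p] =
    ~` [set p | 0 < n.+1%:R * `|height x l p| - size1 p].
  by apply/seteqP; split=> p /=; rewrite subr_gt0 => h; [apply/negP|move/negP: h]; rewrite -leNgt.
apply: measurableC; apply: measurable_positive => p.
apply: (@continuousB _ _ _ (fun p : space => n.+1%:R * `|height x l p|) size1).
  apply: (@continuousM _ _ (fun=> n.+1%:R) (fun p : space => `|height x l p|)).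
    exact: cst_continuous.
  apply: continuous_comp; first exact: continuous_height.
  exact: norm_continuous.
exact: continuous_size1.
Qed.

Lemma near_walls_nonincreasing x : {homo near_walls x : n m / (n <= m)%N >-> (m <= n)%O}.
Proof.
move=> n m nm; apply/subsetPset => p [l _ /= h]; exists l => //=.
by apply: le_trans h; rewrite ler_wpM2r // ler_nat.
Qed.

Lemma bigcap_near_walls x : \bigcap_n near_walls x n = walls x.
Proof.
apply/seteqP; split=> p; last first.
  move=> [l _ /= h] n _; exists l => //=; rewrite h normr0 mulr0.
  by apply: le_trans (size1_ge1 p).
move=> near_p; apply: contrapT => nw.
have h_gt0 l : 0 < `|height x l p|.
  by rewrite normr_gt0; apply/eqP => h0; apply: nw; exists l.
pose M : R := \sum_l size1 p / `|height x l p|.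
have /archi_boundP : 0 <= M.
  by apply: sumr_ge0 => l _; rewrite divr_ge0 // (le_trans ler01) ?size1_ge1.
set n := Num.bound M => ltM.
have [l _ /=] := near_p n I; apply/negP; rewrite -ltNge -ltr_pdivrMr //.
apply: le_lt_trans (_ : M < _).
  rewrite /M (bigD1 l) //= lerDl; apply: sumr_ge0 => i _.
  by rewrite divr_ge0 // (le_trans ler01) ?size1_ge1.
by apply: lt_le_trans ltM _; rewrite ler_nat.
Qed.

(** These sets decrease to the walls, which are null, and a finite measure is continuous from
    above. *)
Lemma mass_near_walls mu x e : nonzero_rows x -> 0 < e ->
  exists n, (mu (near_walls x n) < e%:E)%E.
Proof.
move=> nzx e_gt0.
have := @nonincreasing_cvg_mu _ _ _ mu (near_walls x).
case/(_ _ (measurable_near_walls x) _ (@near_walls_nonincreasing x) [set y | (y < e%:E)%E]).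
- by rewrite -ge0_fin_numE ?measure_ge0 // fin_num_measure //; apply: measurable_near_walls.
- by rewrite bigcap_near_walls; apply: measurable_walls.
- rewrite bigcap_near_walls [X in nbhs X](mass_walls mu nzx); apply: open_nbhs_nbhs; split=> //=.
  exact: open_ereal_lt_ereal.
by move=> n _ /(_ n (leqnn n)) lt_e; exists n.
Qed.

Lemma height_near x x' l p e : (forall q, `|x' q - x q| < e) ->
  `|height x' l p - height x l p| <= e * size1 p.
Proof.
move=> near_x; have -> : height x' l p - height x l p = (x (l, ord_max) - x' (l, ord_max)) +
    \sum_(i < d) (x' (l, widen_ord (leqnSn d) i) - x (l, widen_ord (leqnSn d) i)) * p ord0 i.
  by rewrite /height; under [in RHS]eq_bigr => i _ do rewrite mulrBl; rewrite sumrB; ring.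
apply: le_trans (ler_normD _ _) _; rewrite /size1 mulrDr mulr1 lerD //.
  by rewrite distrC ltW // near_x.
rewrite mulr_sumr; apply: le_trans (ler_norm_sum _ _ _) _; apply: ler_sum => i _.
by rewrite normrM ler_wpM2r // ltW.
Qed.

Lemma region_near x x' s n : (forall q, `|x' q - x q| < n.+1%:R^-1) ->
  region x' s `\` near_walls x n = region x s `\` near_walls x n.
Proof.
move=> near_x.
have sgn p l : ~ near_walls x n p ->
    (0 < height x' l p) = (0 < height x l p) /\ (height x' l p < 0) = (height x l p < 0).
  move=> nn.
  have far : size1 p / n.+1%:R < `|height x l p|.
    by rewrite ltr_pdivrMr ?ltr0Sn // mulrC ltNge; apply/negP => h; apply: nn; exists l.
  have := height_near l p near_x; rewrite mulrC ler_distl => /andP[h1 h2].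
  have e_ge0 : 0 <= size1 p / n.+1%:R.
    by rewrite divr_ge0 // (le_trans ler01) ?size1_ge1.
  move: far h1 h2 e_ge0; set e := _ / _ => far h1 h2 e_ge0.
  move: far; rewrite ltr_normr => /orP[] h3.
    have h4 : 0 < height x l p.
      by apply: le_lt_trans h3.
    have h5 : 0 < height x' l p by lra.
    by rewrite h4 h5 (lt_gtF h4) (lt_gtF h5).
  have h4 : height x l p < 0.
    rewrite -oppr_gt0.
    by apply: le_lt_trans h3.
  have h5 : height x' l p < 0 by lra.
  by rewrite h4 h5 (lt_gtF h4) (lt_gtF h5).
apply/seteqP; split=> p [rp np]; split=> // l; have := rp l.
  by have [-> ->] := sgn p l np.
by have [-> ->] := sgn p l np.
Qed.

(** Outside [near_walls x n] a small move changes no sign, and that set itself weighs less than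
    [e]. *)
Lemma continuous_weight mu s x : nonzero_rows x ->
  continuous_at (fun x : config => weight mu x s) x.
Proof.
move=> nzx e e_gt0; have [n mu_n] := mass_near_walls mu nzx e_gt0.
exists n.+1%:R^-1; first by rewrite invr_gt0 ltr0Sn.
move=> x' near_x; rewrite -[_ < e]lte_fin.
set B := near_walls x n in mu_n; have mB : measurable (B : set (borel_rV R d)).
  exact: measurable_near_walls.
have split_weight y : exists2 u, weight mu y s = fine (mu (region y s `\` B)) + u &
    0 <= u < e.
  have mA := measurable_region y s.
  have mAB : measurable (region y s `&` B : set (borel_rV R d)) by apply: measurableI.
  exists (fine (mu (region y s `&` B))).
    rewrite /weight (measureDI mu mA mB) fineD // fin_num_measure //.
    exact: measurableD.
  rewrite fine_ge0 ?measure_ge0 //=.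
  rewrite -lte_fin fineK ?fin_num_measure //; apply: le_lt_trans mu_n.
  exact: (le_measure mu (mem_set mAB) (mem_set mB) (@subIsetr _ _ _)).
have [u -> /andP[u0 ue]] := split_weight x'; have [v -> /andP[v0 ve]] := split_weight x.
rewrite (region_near _ near_x) opprD addrACA subrr add0r lte_fin ltr_norml; lra.
Qed.

End Continuity.

Lemma continuous_at_sum (R : realType) (d k : nat) (I : finType)
    (T : I -> ('I_k * 'I_d.+1 -> R) -> R) x :
  (forall i, continuous_at (T i) x) -> continuous_at (fun x => \sum_i T i x) x.
Proof.
move=> cT e e_gt0.
have : forall r : seq I, continuous_at (fun x => \sum_(i <- r) T i x) x.
  elim=> [|i r IHr] {e_gt0}e e_gt0.
    by exists 1 => // x' _; rewrite !big_nil subrr normr0.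
  have e2 : 0 < e / 2 by rewrite divr_gt0.
  have [e1 e1_gt0 T1] := cT i _ e2; have [e3 e3_gt0 T3] := IHr _ e2.
  exists (Num.min e1 e3); first by rewrite lt_min e1_gt0.
  move=> x' near_x; rewrite !big_cons opprD addrACA.
  have near13 p : `|x' p - x p| < e1 /\ `|x' p - x p| < e3.
    by have := near_x p; rewrite lt_min => /andP[].
  have {}T1 := T1 x' (fun p => (near13 p).1); have {}T3 := T3 x' (fun p => (near13 p).2).
  by apply: le_lt_trans (ler_normD _ _) _; lra.
by move/(_ (index_enum I) e e_gt0).
Qed.

Lemma continuous_at_scale (R : realType) (d k : nat) (a : R)
    (T : ('I_k * 'I_d.+1 -> R) -> R) x :
  `|a| <= 1 -> continuous_at T x -> continuous_at (fun x => a * T x) x.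
Proof.
move=> a1 cT e /cT[e' e'_gt0 near_x]; exists e' => // x' /near_x.
by rewrite -mulrBr normrM; apply: le_lt_trans; rewrite ler_piMl.
Qed.

(** * Fourier coefficients of the orthant measures *)

Section Characters.
Variables (R : realType) (d k : nat) (mu : mass R d).
Local Notation config := ('I_k * 'I_d.+1 -> R).
Local Notation signs := {ffun 'I_k -> bool}.
Implicit Types (x : config) (s t : signs) (al : {set 'I_k}) (l : 'I_k).

Definition sign (b : bool) : R := if b then 1 else -1.
(** The characters of the group of sign vectors; [transform] gives the f_A of the overview. *)
Definition character al s : R := \prod_(l in al) sign (s l).
Definition transform al x : R := \sum_s character al s * weight mu x s.

Lemma normr_character al s : `|character al s| = 1.
Proof.
rewrite /character normr_prod big1 // => l _.
by rewrite /sign; case: (s l); rewrite ?normrN normr1.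
Qed.

Lemma continuous_transform al x : nonzero_rows x -> continuous_at (transform al) x.
Proof.
move=> nzx; apply: continuous_at_sum => s; apply: continuous_at_scale.
  by rewrite normr_character.
exact: continuous_weight.
Qed.

Definition toggle l s : signs := [ffun i => (i == l) (+) s i].

Lemma toggleK l : involutive (toggle l).
Proof. by move=> s; apply/ffunP=> i; rewrite !ffunE addbA addbb. Qed.

Lemma height_negate x l i p :
  height (negate l x) i p = if i == l then - height x i p else height x i p.
Proof.
rewrite /height /negate /=; case: eqP => // _; rewrite opprB opprK addrC; congr (_ + _).
by rewrite -sumrN; apply: eq_bigr => j _; rewrite mulNr.
Qed.

Lemma region_negate x l s : region (negate l x) s = region x (toggle l s).
Proof.
apply/seteqP; split=> p rp i; have := rp i; rewrite height_negate ffunE;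
  by case: (i == l) => //=; rewrite oppr_gt0 oppr_lt0; case: (s i).
Qed.

Lemma character_toggle al l s :
  character al (toggle l s) = (-1) ^+ (l \in al) * character al s.
Proof.
have sgnC i : i != l -> sign (toggle l s i) = sign (s i) by rewrite ffunE => /negPf->.
have [l_al|l_al] := boolP (l \in al); last first.
  rewrite mul1r; apply: eq_bigr => i i_al; apply: sgnC.
  by apply: contraNneq l_al => <-.
rewrite /character (bigD1 l) //= [X in _ = _ * X](bigD1 l) //= mulrA; congr (_ * _).
  by rewrite ffunE eqxx /sign expr1 mulN1r /=; case: (s l); rewrite ?opprK.
by apply: eq_bigr => i /andP[_ /sgnC].
Qed.

Lemma odd_transform al : odd_in al (transform al).
Proof.
move=> l x _; rewrite /transform mulr_sumr (reindex_inj (inv_inj (toggleK l))) /=.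
apply: eq_bigr => s _; rewrite character_toggle mulrA; congr (_ * _).
by rewrite /weight region_negate toggleK.
Qed.

Lemma transform0 x : nonzero_rows x -> transform finset.set0 x = total mu.
Proof.
move=> nzx; rewrite -(sum_weight mu nzx); apply: eq_bigr => s _.
by rewrite /character big_set0 mul1r.
Qed.

(** The sum over subsets factors into terms s_l t_l + 1 with signs read as 1 and -1, and a single
    disagreement makes one of them zero. *)
Lemma sum_character s t :
  \sum_(al : {set 'I_k}) character al s * character al t = if s == t then 2 ^+ k else 0.
Proof.
transitivity (\prod_(l < k) (sign (s l) * sign (t l) + 1)).
  rewrite bigA_distr; apply: eq_bigr => al _.
  by rewrite /character -big_split /= [LHS]big_mkcond.
have [->|st] := eqVneq s t.
  rewrite (eq_bigr (fun=> 2)) ?prodr_const ?card_ord // => l _.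
  by rewrite /sign; case: (t l); ring.
have [l sl] : exists l, s l != t l.
  by apply/existsP; rewrite -negb_forall; apply: contra st => /forallP st;
    apply/eqP/ffunP => l; apply/eqP.
rewrite (bigD1 l) //= /sign; move: sl; case: (s l); case: (t l) => // _; ring.
Qed.

Lemma weight_transform x t :
  2 ^+ k * weight mu x t = \sum_(al : {set 'I_k}) character al t * transform al x.
Proof.
under eq_bigr => al _ do rewrite /transform mulr_sumr.
rewrite exchange_big /= (bigD1 t) //= [X in _ + X]big1 ?addr0 => [|s st].
  under eq_bigr => al _ do rewrite mulrA.
  by rewrite -mulr_suml sum_character eqxx.
under eq_bigr => al _ do rewrite mulrA.
by rewrite -mulr_suml sum_character eq_sym (negPf st) mul0r.
Qed.

Lemma weight_of_zeros x t : nonzero_rows x ->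
  (forall al, al != finset.set0 -> transform al x = 0) ->
  weight mu x t = (2 ^+ k)^-1 * total mu.
Proof.
move=> nzx tr0; have two_neq0 : 2 ^+ k != 0 :> R by rewrite expf_neq0 // pnatr_eq0.
apply: (mulfI two_neq0); rewrite mulrA mulfV // mul1r weight_transform.
rewrite (bigD1 finset.set0) //= transform0 // /character big_set0 mul1r big1 ?addr0 //.
by move=> al /tr0->; rewrite mulr0.
Qed.

End Characters.

Section Symmetry.
Variables (R : realType) (d k : nat) (mu : mass R d).
Local Notation config := ('I_k * 'I_d.+1 -> R).
Local Notation signs := {ffun 'I_k -> bool}.
Implicit Types (x : config) (s t : signs) (al : {set 'I_k}) (l a b : 'I_k).

Lemma transform_swap a b al x :
  transform mu (swap_set a b al) (fun p => x (tperm a b p.1, p.2)) = transform mu al x.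
Proof.
pose sw s : signs := [ffun l => s (tperm a b l)].
have swK : involutive sw by move=> s; apply/ffunP=> l; rewrite !ffunE tpermK.
rewrite /transform (reindex_inj (inv_inj swK)) /=; apply: eq_bigr => s _.
congr (_ * fine (mu _)).
  rewrite /character [RHS](reindex_inj (@perm_inj _ (tperm a b))) /=.
  by apply: eq_big => [l|l _]; rewrite ?inE ?ffunE.
apply/seteqP; split=> p rp l.
  by have := rp (tperm a b l); rewrite ffunE tpermK /height /= tpermK.
by have := rp (tperm a b l); rewrite ffunE /height /=.
Qed.

(** The heights of the two rows agree up to a common sign, so the character has the same value on
    all nonempty regions. *)
Lemma transform_diagonal a b x : a != b -> nonzero_rows x ->
  (forall i, x (a, i) = x (b, i)) \/ (forall i, x (a, i) = - x (b, i)) ->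
  `|transform mu [set a; b] x| = total mu.
Proof.
move=> ab nzx diag.
have total_ge0 : 0 <= total mu by rewrite fine_ge0 // measure_ge0.
have charE s : character R [set a; b] s = sign R (s a) * sign R (s b).
  by rewrite /character big_setU1 ?inE //= big_set1.
have tr (c : bool) : (forall s p, region x s p -> s a (+) s b = c) ->
    transform mu [set a; b] x = (-1) ^+ c * total mu.
  move=> reg; rewrite -(sum_weight mu nzx) mulr_sumr; apply: eq_bigr => s _.
  have [sc|sc] := eqVneq (s a (+) s b) c.
    congr (_ * _); rewrite charE -sc /sign.
    by case: (s a); case: (s b); rewrite /= ?expr0 ?expr1 ?mulr1 ?mul1r ?mulrNN ?mulr1.
  suff -> : weight mu x s = 0 by rewrite !mulr0.
  rewrite /weight; suff -> : region x s = set0 by rewrite measure0.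
  by apply/seteqP; split=> p // /reg /eqP; rewrite (negPf sc).
case: diag => diag.
  have he p : height x a p = height x b p.
    by rewrite /height diag; congr (_ - _); apply: eq_bigr => i _; rewrite diag.
  rewrite (tr false) ?mul1r ?ger0_norm // => s p rp.
  have := rp a; have := rp b; rewrite he; case: (s a); case: (s b) => //= h1 h2;
    by have := lt_trans h1 h2; rewrite ltxx.
have he p : height x a p = - height x b p.
  rewrite /height diag opprB opprK addrC; congr (_ + _).
  by rewrite -sumrN; apply: eq_bigr => i _; rewrite diag mulNr.
rewrite (tr true) ?expr1 ?mulN1r ?normrN ?ger0_norm // => s p rp.
have := rp a; have := rp b; rewrite he oppr_gt0 oppr_lt0.
by case: (s a); case: (s b) => //= h1 h2; have := lt_trans h1 h2; rewrite ltxx.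
Qed.

End Symmetry.

(** * Equipartitions *)

Section Equiparts.
Variables (R : realType).

Lemma orthant_region d k (x : 'I_k * 'I_d.+1 -> R) (H : 'I_k -> hyperplane R d) s :
  (forall l, normal (H l) = normal_row x l) -> (forall l, offset (H l) = x (l, ord_max)) ->
  orthant H s = region x [ffun l => s l].
Proof.
move=> nH oH; apply/seteqP; split=> p rp l; have := rp l; rewrite /open_side ffunE heightE.
  by rewrite nH oH; case: (s l) => /=; rewrite ?subr_gt0 ?subr_lt0.
by rewrite -nH -oH; case: (s l) => /=; rewrite ?subr_gt0 ?subr_lt0.
Qed.

Lemma measurable_orthant d k (H : 'I_k -> hyperplane R d) s :
  measurable (orthant H s : set (borel_rV R d)).
Proof.
pose x (q : 'I_k * 'I_d.+1) : R :=
  if unlift ord_max q.2 is Some i then normal (H q.1) ord0 i else offset (H q.1).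
rewrite (@orthant_region _ _ x); first exact: measurable_region.
  move=> l; apply/rowP=> i; rewrite mxE /x /=.
  have -> : widen_ord (leqnSn d) i = lift ord_max i by apply: val_inj; rewrite /= /bump leqNgt ltn_ord.
  by rewrite liftK.
by move=> l; rewrite /x /= unlift_none.
Qed.

Lemma equiparts_null d k (H : 'I_k -> hyperplane R d) (mu : mass R d) :
  mu [set: 'rV[R]_d] = 0%E -> equiparts H mu.
Proof.
move=> mu0 s; rewrite mu0 mule0.
exact: subset_measure0 (measurable_orthant H s) measurableT (@subsetT _ _) mu0.
Qed.

Lemma equiparts_of_zeros d k (I : Type) (i0 : I) (mu : I -> mass R d)
    (x : 'I_k * 'I_d.+1 -> R) :
  (forall i, mu i [set: 'rV[R]_d] != 0%E) -> nonzero_rows x ->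
  (forall al i, al != finset.set0 -> transform (mu i) al x = 0) ->
  exists H : 'I_k -> hyperplane R d, forall i, equiparts H (mu i).
Proof.
move=> mu0 nzx tr0.
have wE i t := weight_of_zeros t nzx (fun al => tr0 al i).
have n0 l : normal_row x l != 0.
  apply/eqP => n0; have := mu0 i0; rewrite totalE eqe; case/eqP.
  (* With zero normal the height is the constant [- x (l, ord_max)], and [t] asks for a sign it does
     not have; the empty region would carry a positive share of the mass. *)
  pose t : {ffun 'I_k -> bool} := [ffun=> x (l, ord_max) > 0].
  have := wE i0 t; rewrite /weight.
  have -> : region x t = set0.
    apply/seteqP; split=> p // /(_ l); rewrite ffunE heightE n0 /dotv big1 => [|i _].
      by rewrite sub0r oppr_gt0 oppr_lt0; case: ltrgtP.
    by rewrite mxE mul0r.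
  rewrite measure0 => /esym/eqP; rewrite mulf_eq0 invr_eq0 expf_eq0 pnatr_eq0 andbF /=.
  by move/eqP.
exists (fun l => Hyperplane (x (l, ord_max)) (n0 l)) => i s.
by rewrite (@orthant_region _ _ x) // weightE wE totalE.
Qed.

(** A null mass is equiparted by anything, so a nonnull one may take its place; if all are null,
    [0 < d] provides a hyperplane. *)
Lemma equipartable_positive j k d : (0 < d)%N ->
  (forall mu : 'I_j -> mass R d, (forall i, mu i [set: 'rV[R]_d] != 0%E) ->
    exists H : 'I_k -> hyperplane R d, forall i, equiparts H (mu i)) ->
  equipartable R j k d.
Proof.
move=> d_gt0 pos mu.
have [[i1 mu1]|all0] := pselect (exists i, mu i [set: 'rV[R]_d] != 0%E); last first.
  have n0 : (const_mx 1 : 'rV[R]_d) != 0.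
    apply/eqP => /rowP/(_ (Ordinal d_gt0)); rewrite !mxE => /eqP.
    by rewrite oner_eq0.
  exists (fun=> Hyperplane 0 n0) => i; apply: equiparts_null.
  by apply/eqP/negPn/negP => mui; apply: all0; exists i.
have [i|H eqH] := pos (fun i => if mu i [set: 'rV[R]_d] == 0%E then mu i1 else mu i).
  by case: ifP => // /negbT.
exists H => i; have [mu0|mu0] := eqVneq (mu i [set: 'rV[R]_d]) 0%E.
  exact: equiparts_null.
by have := eqH i; rewrite (negPf mu0).
Qed.

Lemma equipartable_one j d : (0 < j <= d)%N -> equipartable R j 1 d.
Proof.
move=> /andP[j_gt0 le_jd]; apply: equipartable_positive => [|mu mu0].
  exact: leq_trans le_jd.
have [|||x nzx tr0] := @common_zero_sphere R d j (fun i => transform (mu i) [set ord0]).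
- by rewrite j_gt0.
- by move=> i; apply: odd_transform.
- by move=> i x; apply: continuous_transform.
apply: (equiparts_of_zeros (Ordinal j_gt0) mu0 nzx) => al i /set0Pn[l l_al].
suff -> : al = [set ord0]%SET by apply: tr0.
by apply/setP=> l'; rewrite inE [l']ord1 eqxx -(ord1 l).
Qed.

Lemma dim_sub n s r : (r <= 2 ^ s)%N ->
  (dim n s - (2 ^ s.+1 - (2 ^ s + r)) = 2 ^ (s + n.+1) + r)%N.
Proof.
move=> le_r; rewrite /dim (expnS 2 s) expnD mulnDr muln1.
by move: (2 ^ s * 2 ^ n.+1)%N => m; lia.
Qed.

Lemma equipartable_power n s r : (0 < r <= 2 ^ s)%N ->
  equipartable R (2 ^ s + r) n.+2 (2 ^ (s + n.+1) + r).
Proof.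
move=> /andP[r_gt0 le_r]; rewrite -(dim_sub n le_r).
set j := (2 ^ s + r)%N.
have j_gt1 : (1 < j)%N.
  by rewrite /j -(addn1 1) leq_add // expn_gt0.
have j_le : (j <= 2 ^ s.+1)%N by rewrite expnS mul2n -addnn leq_add2l.
apply: equipartable_positive => [|mu mu0].
  by rewrite dim_sub // addn_gt0 r_gt0 orbT.
(* The total of the first mass serves as [kappa]: by [transform_diagonal] it is the absolute value
   of f_ab on the diagonal. *)
pose i0 := Ordinal (ltnW j_gt1).
have mu_gt0 : 0 < total (mu i0).
  by rewrite lt_neqAle eq_sym -eqe -totalE mu0 fine_ge0 // measure_ge0.
have [| | | |x nzx tr0] := @common_zero_product R n s j j_gt1 j_le
  (fun al i => transform (mu i) al) _ mu_gt0.
- by move=> al i; apply: odd_transform.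
- by move=> al i x; apply: continuous_transform.
- by move=> al i x _; apply: transform_swap.
- by move=> x nzx diag; rewrite transform_diagonal // neq_xy.
exact: (equiparts_of_zeros i0 mu0 nzx tr0).
Qed.

End Equiparts.

(** * Bisecting a single mass *)

Section Restriction.
Variables (R : realType) (d : nat).
Implicit Types (mu : mass R d) (H : hyperplane R d).

Lemma orthant1 (H : 'I_1 -> hyperplane R d) s : orthant H s = open_side (H ord0) (s ord0).
Proof. by apply/seteqP; split=> p; [move/(_ ord0)|move=> hp l; rewrite (ord1 l)]. Qed.

Lemma measurable_open_side H b : measurable (open_side H b : set (borel_rV R d)).
Proof.
by have := measurable_orthant (fun _ : 'I_1 => H) (fun=> b); rewrite orthant1.
Qed.

Lemma measurable_hyperplane H : measurable (hyperplane_set H : set (borel_rV R d)).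
Proof.
have -> : hyperplane_set H = ~` (open_side H true `|` open_side H false).
  apply/seteqP; split=> p /=; first by move=> ->; rewrite ltxx; case.
  by move=> /not_orP[/negP + /negP]; case: ltrgtP.
by apply: measurableC; apply: measurableU; apply: measurable_open_side.
Qed.

Lemma restricted_hyperplane mu (A : set (borel_rV R d)) (mA : measurable A) H :
  mrestr mu mA (hyperplane_set H) = 0%E.
Proof.
have mH := measurable_hyperplane H.
exact: subset_measure0 (measurableI _ _ mH mA) mH (@subIsetl _ _ _) (mass_hyperplane mu H).
Qed.

Definition restricted_mass mu (A : set (borel_rV R d)) (mA : measurable A) : mass R d :=
  @Mass R d (mrestr mu mA) (restricted_hyperplane mu mA).

Lemma equipartable_bisect k : (0 < d)%N ->
  equipartable R 2 k d -> equipartable R 1 k.+1 d.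
Proof.
move=> d_gt0 eq2 mu.
have [H0 eqH0] := @equipartable_one R 1 d d_gt0 mu.
pose side b := measurable_open_side (H0 ord0) b.
have [H eqH] := eq2 (fun i => restricted_mass (mu ord0) (side (i == ord0))).
exists (fun l => if unlift ord0 l is Some l' then H l' else H0 ord0) => i s.
rewrite [i]ord1.
have -> : orthant (fun l => if unlift ord0 l is Some l' then H l' else H0 ord0) s =
    orthant H (fun l => s (lift ord0 l)) `&` open_side (H0 ord0) (s ord0).
  apply/seteqP; split=> p /= => [hp|[hp h0] l].
    by split=> [l|]; [have := hp (lift ord0 l)|have := hp ord0]; rewrite ?liftK ?unlift_none.
  by case: unliftP => [l' ->|->]; rewrite ?liftK ?unlift_none.
have := eqH0 ord0 (fun=> s ord0); rewrite orthant1 => half.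
(* The mass of index [ord0] is the half on the positive side, so [s ord0] selects the half. *)
have := eqH (if s ord0 then ord0 else ord_max) (fun l => s (lift ord0 l)).
rewrite /restricted_mass /= /mrestr setTI.
have -> : ((if s ord0 then ord0 else ord_max) == ord0 :> 'I_2) = s ord0 by case: (s ord0).
move=> ->; rewrite half muleA -EFinM; congr (_%:E * _)%E.
by rewrite expr1 exprSr invfM.
Qed.

End Restriction.

(** * Bounds on the minimal dimension *)

Section Delta.
Variable R : realType.

Lemma exists_Delta j k d : (0 < d)%N -> equipartable R j k d ->
  exists D, is_Delta R j k D /\ (D <= d)%N.
Proof.
move=> d_gt0 eqd.
have ex : exists d, (0 < d)%N && `[< equipartable R j k d >].
  by exists d; rewrite d_gt0; apply/asboolP.
case: (ex_minnP ex) => D /andP[D_gt0 /asboolP eqD] minD; exists D; split.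
  by split=> // d' d'_gt0 eqd'; apply: minD; rewrite d'_gt0; apply/asboolP.
by apply: minD; rewrite d_gt0; apply/asboolP.
Qed.

Lemma Delta_power n r k : (0 < r <= 2 ^ n)%N -> (0 < k)%N ->
  exists D, is_Delta R (2 ^ n + r) k D /\ (D <= 2 ^ (n + k - 1) + r)%N.
Proof.
move=> r_bd; have r_gt0 : (0 < r)%N by case/andP: r_bd.
case: k => [//|[|k]] _; apply: exists_Delta; rewrite ?addn_gt0 ?r_gt0 ?orbT //.
  by apply: equipartable_one; rewrite addn_gt0 r_gt0 orbT addnK /=.
rewrite (_ : (n + k.+2 - 1 = n + k.+1)%N); last by rewrite addnS subn1.
exact: equipartable_power.
Qed.

Lemma Delta_single k : (0 < k)%N ->
  exists D, is_Delta R 1 k D /\ (D <= if (2 <= k)%N then 2 ^ (k - 2) + 1 else 1)%N.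
Proof.
case: k => [//|[|k]] _; first by apply: exists_Delta => //; apply: equipartable_one.
apply: exists_Delta; first by rewrite addn1.
apply: equipartable_bisect; first by rewrite addn1.
(* Two masses are 2^0 + 1. If only one hyperplane is left there are no two rows to swap, and
   [equipartable_one] suffices. *)
rewrite subSS subn1 /=; case: k => [|k]; first exact: equipartable_one.
exact: (@equipartable_power R k 0 1).
Qed.

Lemma floor_log2 n (x : R) : 2 ^+ n <= x < 2 ^+ n.+1 -> Num.floor (log2 x) = n%:Z.
Proof.
move=> /andP[le_x lt_x]; apply: floor_def; rewrite /log2.
have ln2 : 0 < ln (2 : R) by rewrite ln_gt0 // ltr1n.
have pow_gt0 m : 0 < 2 ^+ m :> R by rewrite exprn_gt0.
have x_gt0 := lt_le_trans (pow_gt0 n) le_x.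
have lnE m : m%:R = ln (2 ^+ m) / ln 2 :> R.
  by rewrite lnXn // -(mulr_natl (ln 2) m) mulfK // gt_eqF.
rewrite -[(n%:Z + 1)%R]/(Posz (n + 1)) addn1 -!pmulrn (lnE n) (lnE n.+1) ler_pM2r ?invr_gt0 //.
by rewrite ltr_pM2r ?invr_gt0 // ler_ln ?posrE // ltr_ln ?posrE // le_x.
Qed.

Lemma floor_log2_half : Num.floor (log2 (2^-1 : R)) = -1.
Proof.
have ln2 : 0 < ln (2 : R) by rewrite ln_gt0 // ltr1n.
rewrite /log2 lnV ?posrE // mulNr mulfV ?gt_eqF //.
by rewrite -(mulrN1z 1) intrKfloor.
Qed.

End Delta.

Theorem theorem1p2 (R : realType) :
  [/\ forall j k : nat, (1 <= j)%N -> (1 <= k)%N ->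
        exists D : nat, is_Delta R j k D /\
          D%:Z <= Num.ceil (j%:R + (2 ^+ (k - 1) - 1) *
                                     2 ^ Num.floor (log2 (j%:R - 2^-1 : R)) : R),
      forall n r k : nat, (1 <= r <= 2 ^ n)%N -> (1 <= k)%N ->
        exists D : nat, is_Delta R (2 ^ n + r) k D /\
          (D <= 2 ^ (n + k - 1) + r)%N
    & forall k : nat, (1 <= k)%N ->
        exists D : nat, is_Delta R 1 k D /\
          (D <= if (2 <= k)%N then 2 ^ (k - 2) + 1 else 1)%N].
Proof.
split=> [j k j_gt0 k_gt0|n r k|k]; [|exact: Delta_power|exact: Delta_single].
(* For j = 1 the exponent is -1, and for k >= 2 the bound is the ceiling of 2^(k-2) + 1/2. *)
have [->|j_neq1] := eqVneq j 1%N.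
  have [D [isD leD]] := Delta_single R k_gt0; exists D; split=> //.
  rewrite (_ : 1 - 2^-1 = 2^-1 :> R); last by field.
  rewrite floor_log2_half; case: k k_gt0 leD {isD} => [//|[|k]] _ leD.
    by rewrite expr0 subrr mul0r addr0 ceil1 lez_nat.
  apply: (@le_trans _ _ (2 ^ k + 1)%:Z); first by move: leD; rewrite subSS subn1.
  rewrite PoszD -ltzD1 ltrD2r ceil_gt_int.
  rewrite subSS subn0 exprS -pmulrn natrX exprN1.
  have : 0 < 2 ^+ k :> R by rewrite exprn_gt0.
  lra.
have j_gt1 : (1 < j)%N by rewrite ltn_neqAle eq_sym j_neq1.
(* Taking [j.-1] gives 2^n < j <= 2^(n+1), so that r may be 2^n but not 0; accordingly j - 1/2 lies
   strictly between these powers. *)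
pose n := trunc_log 2 j.-1.
have /andP[le_n lt_n] : (2 ^ n <= j.-1 < 2 ^ n.+1)%N.
  by apply: trunc_log_bounds => //; rewrite -ltnS prednK.
pose r := (j - 2 ^ n)%N.
have jE : j = (2 ^ n + r)%N by rewrite /r subnKC // (leq_trans le_n) // leq_pred.
have r_bd : (1 <= r <= 2 ^ n)%N.
  move: le_n lt_n; rewrite /r expnS; move: (2 ^ n)%N => q; lia.
have [D [isD leD]] := Delta_power R r_bd k_gt0; rewrite -jE in isD.
exists D; split=> //; rewrite (@floor_log2 _ n).
  apply: (@le_trans _ _ (2 ^ (n + k - 1) + r)%:Z); first by rewrite lez_nat.
  rewrite -[leLHS](@intrKceil R); apply: le_ceil; rewrite -pmulrn.
  rewrite {1}jE -exprnP -addnBA // !natrD !natrX exprD mulrBl mul1r; lra.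
have : (2 ^ n.+1)%:R = 2 * (2 ^ n)%:R :> R by rewrite -natrM -expnS.
rewrite -!natrX => ->; move: r_bd; rewrite -!(ler_nat R) {1 2}jE natrD => /andP[]; lra.
Qed.
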